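(* Let $p$ be a prime. Suppose that $0<q_1\leq q_2<\infty$, $1<r<\infty$, $\frac1r+\frac1{r'}=1$, $-\frac1r<\alpha<\frac1{r'}$ and $b\in CMO^{\max\{r',r\}}(\mathbb{Q}_p)$. Then $T^p_b$ is bounded from $K^{\alpha,q_1}_r(\mathbb{Q}_p)$ to $K^{\alpha,q_2}_r(\mathbb{Q}_p)$.
   Context: $\mathbb{Q}_p$ is the field of $p$-adic numbers with norm $|\cdot|_p$ normalized by $|p|_p=p^{-1}$, and $\mathbb{Q}_p^*=\mathbb{Q}_p\setminus\{0\}$. $dx$ is the Haar measure on $\mathbb{Q}_p$ normalized so that $\{x:|x|_p\le 1\}$ has measure $1$; $|E|_H$ is the Haar measure of $E$. For $k\in\mathbb{Z}$, $B_k=\{x\in\mathbb{Q}_p:|x|_p\le p^k\}$, $S_k=B_k\setminus B_{k-1}$, and $\chi_k=\chi_{S_k}$ is the characteristic function of $S_k$. The $p$-adic Hardy-Littlewood-Pólya operator is $$T^pf(x)=\int_{\mathbb{Q}_p^*}\frac{f(y)}{\max(|x|_p,|y|_p)}\,dy,\qquad x\in\mathbb{Q}_p,$$ and for a locally integrable $b$ on $\mathbb{Q}_p$ its commutator is $T^p_bf=b\,T^pf-T^p(bf)$. For $1\le s<\infty$, $CMO^s(\mathbb{Q}_p)$ is the set of $f\in L^s_{loc}(\mathbb{Q}_p)$ with $$\|f\|_{CMO^s(\mathbb{Q}_p)}=\sup_{\gamma\in\mathbb{Z}}\left(\frac{1}{|B_\gamma|_H}\int_{B_\gamma}|f(x)-f_{B_\gamma}|^s\,dx\right)^{1/s}<\infty,\qquad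 f_{B_\gamma}=\frac{1}{|B_\gamma|_H}\int_{B_\gamma}f(x)\,dx.$$ For $\alpha\in\mathbb{R}$, $0<q,r<\infty$, the homogeneous $p$-adic Herz space $K^{\alpha,q}_r(\mathbb{Q}_p)$ is the set of $f\in L^r_{loc}(\mathbb{Q}_p)$ with $$\|f\|_{K^{\alpha,q}_r(\mathbb{Q}_p)}=\left(\sum_{k=-\infty}^{+\infty}p^{k\alpha q}\|f\chi_k\|_{L^r(\mathbb{Q}_p)}^q\right)^{1/q}<\infty.$$ An operator $A$ is bounded from $X$ to $Y$ if there is a constant $C$ (independent of $f$) with $\|Af\|_Y\le C\|f\|_X$ for all $f\in X$. *)

(* Defs.v *)
From HB Require Import structures.
From mathcomp Require Import all_boot all_order all_algebra.
From mathcomp Require Import all_classical all_reals all_analysis.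
From mathcomp Require Import ring_quotient ring.
From mathcomp.real_closed Require Import complex.
Set Implicit Arguments. Unset Strict Implicit. Unset Printing Implicit Defensive.
Import Order.TTheory GRing.Theory Num.Theory.
Import numFieldTopology.Exports numFieldNormedType.Exports.
Local Open Scope classical_set_scope.
Local Open Scope ring_scope.
Local Open Scope complex_scope.

(* p ^ (- v_p x), with v_p x = v_p (numq x) - v_p (denq x) *)
Definition rat_padic_abs (R : realType) (p : nat) (x : rat) : R :=
  if x == 0 then 0
  else p%:R ^ (Posz (logn p `|denq x|%N) - Posz (logn p `|numq x|%N)).

Section RatPadicAbs.
Variables (R : realType) (p : nat) (p_pr : prime p).
Local Notation abs := (@rat_padic_abs R p).

Let p_gt1 : 1 < p%:R :> R. Proof. by rewrite ltr1n prime_gt1. Qed.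
Let p_gt0 : 0 < p%:R :> R. Proof. exact: lt_trans ltr01 p_gt1. Qed.
Let p_neq0 : p%:R != 0 :> R. Proof. by rewrite gt_eqF. Qed.

Lemma rat_padic_abs0 : abs 0 = 0.
Proof. by rewrite /rat_padic_abs eqxx. Qed.

Lemma rat_padic_abs_frac (n d : int) : n != 0 -> d != 0 ->
  abs (n%:Q / d%:Q) = p%:R ^ (Posz (logn p `|d|%N) - Posz (logn p `|n|%N)).
Proof.
move=> n0 d0; set x := n%:Q / d%:Q.
have x0 : x != 0 by rewrite mulf_neq0 ?invr_eq0 ?intr_eq0.
rewrite /rat_padic_abs (negbTE x0); congr (_ ^ _).
have E : n * denq x = numq x * d.
  apply: (@intr_inj rat); rewrite !intrM; apply/eqP.
  by rewrite -eqr_div ?intr_eq0// divq_num_den.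
have := congr1 (fun z => logn p `|z|%N) E; rewrite !abszM.
have nx0 : numq x != 0 by rewrite numq_eq0.
rewrite !lognM ?absz_gt0// => F.
apply/eqP; rewrite subr_eq addrAC eq_sym subr_eq -!PoszD eqz_nat.
by rewrite addnC [X in _ == X]addnC -F addnC.
Qed.

Lemma rat_padic_abs_gt0 x : x != 0 -> 0 < abs x.
Proof. by move=> x0; rewrite /rat_padic_abs (negbTE x0) exprz_gt0. Qed.

Lemma rat_padic_abs_ge0 x : 0 <= abs x.
Proof.
have [->|/rat_padic_abs_gt0/ltW//] := eqVneq x 0.
by rewrite rat_padic_abs0.
Qed.

Lemma rat_padic_abs_eq0 x : (abs x == 0) = (x == 0).
Proof.
have [->|x0] := eqVneq x 0; first by rewrite rat_padic_abs0 eqxx.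
by rewrite gt_eqF// rat_padic_abs_gt0.
Qed.

Lemma rat_padic_abs1 : abs 1 = 1.
Proof.
by rewrite -[1]/(1%:Q / 1%:Q) rat_padic_abs_frac// subrr expr0z.
Qed.

Lemma rat_padic_absM x y : abs (x * y) = abs x * abs y.
Proof.
have [->|x0] := eqVneq x 0; first by rewrite mul0r rat_padic_abs0 mul0r.
have [->|y0] := eqVneq y 0; first by rewrite mulr0 rat_padic_abs0 mulr0.
rewrite -{1}[x]divq_num_den -{1}[y]divq_num_den mulf_div -!intrM.
rewrite rat_padic_abs_frac ?mulf_neq0 ?numq_eq0 ?denq_neq0//.
rewrite /rat_padic_abs (negbTE x0) (negbTE y0) -expfzDr// !abszM.
rewrite !lognM ?absz_gt0 ?numq_eq0 ?denq_neq0// !PoszD.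
by congr (_ ^ _); ring.
Qed.

Lemma rat_padic_absV x : abs x^-1 = (abs x)^-1.
Proof.
have [->|x0] := eqVneq x 0; first by rewrite invr0 rat_padic_abs0 invr0.
apply: (mulfI (x := abs x)); first by rewrite rat_padic_abs_eq0.
by rewrite -rat_padic_absM !divff ?rat_padic_abs1 ?rat_padic_abs_eq0.
Qed.

Lemma rat_padic_absN x : abs (- x) = abs x.
Proof. by rewrite /rat_padic_abs oppr_eq0 numqN denqN abszN. Qed.

Lemma rat_padic_absBC x y : abs (x - y) = abs (y - x).
Proof. by rewrite -rat_padic_absN opprB. Qed.

Lemma rat_padic_absD x y : abs (x + y) <= Num.max (abs x) (abs y).
Proof.
have abs1D u : abs u <= 1 -> abs (1 + u) <= 1.
  move=> u1; have [->|u0] := eqVneq (1 + u) 0.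
    by rewrite rat_padic_abs0 ler01.
  have [u00|un0] := eqVneq u 0; first by rewrite u00 addr0 rat_padic_abs1.
  move: u1; rewrite {1}/rat_padic_abs (negbTE un0).
  rewrite -[X in (_ <= X) -> _](expr0z (p%:R : R)) ler_eXz2l// subr_le0 lez_nat => dn.
  have E : 1 + u = (denq u + numq u)%:Q / (denq u)%:Q.
    by rewrite intrD mulrDl divff ?intr_eq0// divq_num_den.
  have N0 : denq u + numq u != 0.
    by apply: contraNneq u0 => N0; rewrite E N0 mul0r.
  rewrite E rat_padic_abs_frac//.
  rewrite -[leRHS](expr0z (p%:R : R)) ler_eXz2l// subr_le0 lez_nat.
  rewrite -pfactor_dvdn ?absz_gt0//.
  have dz (z : int) : (p ^ logn p `|denq u|%N %| `|z|)%N =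
      ((p ^ logn p `|denq u|%N)%:Z %| z)%Z by [].
  rewrite dz rpredD// -dz ?pfactor_dvdnn//.
  by rewrite pfactor_dvdn// absz_gt0 numq_eq0.
wlog xy : x y / abs x <= abs y => [H|].
  have /orP[/H//|/H] := le_total (abs x) (abs y).
  by rewrite addrC maxC.
have [y0|y0] := eqVneq y 0.
  by rewrite y0 addr0 le_max lexx.
rewrite max_r//.
have -> : x + y = y * (1 + x / y) by rewrite mulrDr mulr1 mulrCA divff// mulr1 addrC.
rewrite rat_padic_absM ler_piMr ?rat_padic_abs_ge0// abs1D//.
by rewrite rat_padic_absM rat_padic_absV ler_pdivrMr ?rat_padic_abs_gt0// mul1r.
Qed.

Lemma rat_padic_absB x y : abs (x - y) <= Num.max (abs x) (abs y).
Proof. by rewrite -(rat_padic_absN y) rat_padic_absD. Qed.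

Lemma rat_padic_abs_eq x y : abs (x - y) < abs y -> abs x = abs y.
Proof.
move=> xy; apply/eqP; rewrite eq_le; apply/andP; split.
  by rewrite -[x](subrK y) (le_trans (rat_padic_absD _ _))// ge_max lexx ltW.
rewrite leNgt; apply/negP => yx; have := rat_padic_absD (y - x) x.
by rewrite subrK leNgt gt_max yx rat_padic_absBC xy.
Qed.

End RatPadicAbs.

Section PadicCauchy.
Variables (R : realType) (p : nat) (p_pr : prime p).
Local Notation abs := (@rat_padic_abs R p).

Definition padic_cauchy & prime p : pred (nat -> rat) := fun x =>
  `[< forall e : R, 0 < e -> exists N, forall m n,
      (N <= m)%N -> (N <= n)%N -> abs (x m - x n) < e >].

Lemma padic_cauchy_bounded x : padic_cauchy p_pr x ->
  exists2 M, 0 < M & exists N, forall n, (N <= n)%N -> abs (x n) <= M.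
Proof.
move/asboolP => /(_ 1 ltr01)[N HN].
exists (Num.max 1 (abs (x N))); first by rewrite lt_max ltr01.
exists N => n Nn; rewrite -[x n](subrK (x N)).
rewrite (le_trans (rat_padic_absD _ p_pr _ _))// ge_max !le_max lexx orbT andbT.
by rewrite ltW// HN.
Qed.

Fact padic_cauchy_subring : subring_closed (padic_cauchy p_pr).
Proof.
split=> [|x y /asboolP cx /asboolP cy|x y cx cy].
- apply/asboolP => e e0; exists 0%N => m n _ _.
  by rewrite subrr rat_padic_abs0.
- apply/asboolP => e e0; have [[N HN] [M HM]] := (cx _ e0, cy _ e0).
  exists (maxn N M) => m n; rewrite !geq_max => /andP[Nm Mm] /andP[Nn Mn].
  have -> : (x - y) m - (x - y) n = (x m - x n) - (y m - y n).
    by rewrite !fctE; ring.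
  rewrite (le_lt_trans (rat_padic_absB _ p_pr _ _))// gt_max.
  by rewrite HN ?HM.
- have [A A0 [NA HA]] := padic_cauchy_bounded cx.
  have [B B0 [NB HB]] := padic_cauchy_bounded cy.
  move: cx cy => /asboolP cx /asboolP cy; apply/asboolP => e e0.
  have [N HN] := cx _ (divr_gt0 e0 B0); have [M HM] := cy _ (divr_gt0 e0 A0).
  exists (maxn (maxn NA NB) (maxn N M)) => m n; rewrite !geq_max.
  move=> /andP[/andP[am bm] /andP[Nm Mm]] /andP[/andP[an bn] /andP[Nn Mn]].
  have -> : (x * y) m - (x * y) n = (x m - x n) * y m + x n * (y m - y n).
    by rewrite !fctE; ring.
  rewrite (le_lt_trans (rat_padic_absD _ p_pr _ _))// gt_max.
  rewrite !(rat_padic_absM _ p_pr); apply/andP; split.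
    apply: le_lt_trans (_ : abs (x m - x n) * B < _).
      by rewrite ler_wpM2l ?HB// rat_padic_abs_ge0.
    by rewrite -ltr_pdivlMr// HN.
  apply: le_lt_trans (_ : A * abs (y m - y n) < _).
    by rewrite ler_wpM2r ?HA// rat_padic_abs_ge0.
  by rewrite mulrC -ltr_pdivlMr// HM.
Qed.

HB.instance Definition _ :=
  GRing.isSubringClosed.Build (nat -> rat) (padic_cauchy p_pr)
    padic_cauchy_subring.

Record cauchy_rat := CauchyRat {
  cauchy_seq :> nat -> rat; cauchy_seqP : cauchy_seq \in padic_cauchy p_pr }.

HB.instance Definition _ := [isSub for cauchy_seq].
HB.instance Definition _ := [Choice of cauchy_rat by <:].
HB.instance Definition _ := [SubChoice_isSubComNzRing of cauchy_rat by <:].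

Definition padic_null : pred cauchy_rat := fun x =>
  `[< forall e : R, 0 < e ->
      exists N, forall n, (N <= n)%N -> abs (x n) < e >].

Lemma cauchy_rat_stationary (x : cauchy_rat) : ~~ padic_null x ->
  exists2 c, 0 < c & exists N, forall n, (N <= n)%N -> abs (x n) = c.
Proof.
case: x => x /= xP; move/asboolP: (xP) => cx /asboolPn nx.
move/existsNP : nx => [e /not_implyP[e0 /forallNP nx]].
have [N HN] := cx e e0.
have /existsNP[n /not_implyP[Nn /negP]] := nx N.
rewrite -leNgt /= => en; exists (abs (x n)); first exact: lt_le_trans en.
exists N => m Nm /=.
have xmn : abs (x m - x n) < abs (x n) by exact: lt_le_trans (HN _ _ _ _) en.
exact: rat_padic_abs_eq.
Qed.

Fact padic_null_ideal : idealr_closed padic_null.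
Proof.
split=> [||a u v /asboolP u0 /asboolP v0].
- by apply/asboolP => e e0; exists 0%N => n _; rewrite rat_padic_abs0.
- apply/negP => /asboolP /(_ 1 ltr01)[N /(_ N (leqnn N))].
  by rewrite rat_padic_abs1// ltxx.
- have [A A0 [NA HA]] := padic_cauchy_bounded (cauchy_seqP a).
  apply/asboolP => e e0.
  have [[N HN] [M HM]] := (u0 _ (divr_gt0 e0 A0), v0 _ e0).
  exists (maxn NA (maxn N M)) => n; rewrite !geq_max => /and3P[an Nn Mn].
  have -> : (a * u + v) n = a n * u n + v n by [].
  rewrite (le_lt_trans (rat_padic_absD _ p_pr _ _))// gt_max HM// andbT.
  rewrite (rat_padic_absM _ p_pr).
  apply: le_lt_trans (_ : A * abs (u n) < _).
    by rewrite ler_wpM2r ?HA// rat_padic_abs_ge0.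
  by rewrite mulrC -ltr_pdivlMr// HN.
Qed.

HB.instance Definition _ := isIdealr.Build cauchy_rat padic_null padic_null_ideal.

Lemma cauchy_rat_inv (x : cauchy_rat) : ~~ padic_null x ->
  exists y : cauchy_rat, padic_null (y * x - 1).
Proof.
move=> /cauchy_rat_stationary[c c0 [N HN]].
have xn0 n : (N <= n)%N -> x n != 0.
  by move=> /HN xnc; rewrite -(rat_padic_abs_eq0 R p_pr) xnc gt_eqF.
have yP : (fun n => (x n)^-1) \in padic_cauchy p_pr.
  apply/asboolP => e e0; have /asboolP cx := cauchy_seqP x.
  have [M HM] := cx _ (mulr_gt0 e0 (mulr_gt0 c0 c0)).
  exists (maxn N M) => m n; rewrite !geq_max => /andP[Nm Mm] /andP[Nn Mn].
  have -> : (x m)^-1 - (x n)^-1 = (x n - x m) * ((x m)^-1 * (x n)^-1).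
    by field; rewrite !xn0.
  rewrite !(rat_padic_absM _ p_pr) !(rat_padic_absV _ p_pr) !HN//.
  by rewrite -invfM ltr_pdivrMr ?mulr_gt0// HM.
exists (CauchyRat yP); apply/asboolP => e e0; exists N => n Nn.
have -> : (CauchyRat yP * x - 1) n = (x n)^-1 * x n - 1 by [].
by rewrite mulVf ?xn0// subrr rat_padic_abs0.
Qed.

End PadicCauchy.

(* The completion of the rationals for the p-adic norm: Cauchy sequences modulo
   null sequences. R only serves as the codomain of the norm. *)
Definition Qp (R : realType) (p : nat) (p_pr : prime p) : Type :=
  {ideal_quot (@padic_null R p p_pr : idealr (cauchy_rat R p_pr))}.

Section PadicField.
Variables (R : realType) (p : nat) (p_pr : prime p).
Local Notation Qp := (@Qp R p p_pr).
Local Notation abs := (@rat_padic_abs R p).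
Local Open Scope quotient_scope.


HB.instance Definition _ := GRing.ComNzRing.on Qp.

Definition to_Qp (c : cauchy_rat R p_pr) : Qp :=
  \pi_({ideal_quot (@padic_null R p p_pr : idealr (cauchy_rat R p_pr))}) c.

Lemma to_QpB c d : to_Qp (c - d) = to_Qp c - to_Qp d.
Proof. exact: rmorphB. Qed.

Lemma to_QpD c d : to_Qp (c + d) = to_Qp c + to_Qp d.
Proof. exact: rmorphD. Qed.

Lemma to_QpM c d : to_Qp (c * d) = to_Qp c * to_Qp d.
Proof. exact: rmorphM. Qed.

Lemma to_Qp1 : to_Qp 1 = 1.
Proof. exact: rmorph1. Qed.

Lemma to_Qp_eq0 c : (to_Qp c == 0) = padic_null c.
Proof.
have := Quotient.idealrBE (@padic_null R p p_pr : idealr _) c 0.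
rewrite subr0 => E; rewrite -[RHS]/(c \in @padic_null R p p_pr) E.
by rewrite -(_ : to_Qp 0 = 0) //; exact: rmorph0.
Qed.

Lemma to_Qp_surj x : exists c, x = to_Qp c.
Proof. by exists (repr (x : {ideal_quot _})); rewrite /to_Qp reprK. Qed.

Lemma Qp_inv_exists (x : Qp) : x != 0 -> exists y, y * x = 1.
Proof.
have [c ->] := to_Qp_surj x; rewrite to_Qp_eq0 => /cauchy_rat_inv[d dc].
exists (to_Qp d); apply/eqP; rewrite -subr_eq0 -to_Qp1 -to_QpM -to_QpB.
by rewrite to_Qp_eq0.
Qed.

Definition Qp_inv (x : Qp) : Qp := if x == 0 then 0 else xget 0 [set y | y * x = 1].

Fact Qp_mulVf (x : Qp) : x != 0 -> Qp_inv x * x = 1.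
Proof.
move=> x0; rewrite /Qp_inv (negbTE x0); have [y xy] := Qp_inv_exists x0.
exact: (@xgetPex _ 0 [set y | y * x = 1] (ex_intro _ y xy)).
Qed.

Fact Qp_inv0 : Qp_inv 0 = 0.
Proof. by rewrite /Qp_inv eqxx. Qed.

HB.instance Definition _ := GRing.ComNzRing_isField.Build Qp Qp_mulVf Qp_inv0.

Definition padic_abs (x : Qp) : R :=
  lim ((fun n => abs ((repr (x : {ideal_quot _}) : cauchy_rat R p_pr) n)) @ \oo).

Lemma to_Qp_repr (x : Qp) : to_Qp (repr (x : {ideal_quot _})) = x.
Proof. by rewrite /to_Qp reprK. Qed.

Lemma padic_abs_to_Qp0 c : padic_null c -> padic_abs (to_Qp c) = 0.
Proof.
rewrite -to_Qp_eq0 => /eqP c0; have := to_Qp_repr (to_Qp c).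
rewrite /padic_abs; set d := repr _ => /eqP; rewrite c0 to_Qp_eq0 => /asboolP d0.
apply/cvg_lim => //; apply/cvgrPdist_lt => e e0.
have [N HN] := d0 _ e0; exists N => // n /HN.
by rewrite sub0r normrN ger0_norm ?rat_padic_abs_ge0.
Qed.

Lemma padic_abs_to_Qp (c : cauchy_rat R p_pr) (l : R) : 0 < l ->
  (exists N, forall n, (N <= n)%N -> abs (c n) = l) -> padic_abs (to_Qp c) = l.
Proof.
move=> l0 [N HN]; have := to_Qp_repr (to_Qp c).
rewrite /padic_abs; set d := repr _ => /eqP; rewrite -subr_eq0 -to_QpB to_Qp_eq0.
move=> /asboolP /(_ _ l0)[M HM].
apply/cvg_lim => //; apply: cvg_near_cst; exists (maxn N M) => // n /=.
rewrite geq_max => /andP[/HN cn /HM dc].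
by rewrite (rat_padic_abs_eq p_pr (y := c n)) ?cn.
Qed.

(* For x != 0 the norms of a representing Cauchy sequence are eventually equal
   to the norm of x. *)
Lemma padic_absP (x : Qp) : x != 0 -> exists c : cauchy_rat R p_pr,
  [/\ x = to_Qp c, 0 < padic_abs x &
      exists N, forall n, (N <= n)%N -> abs (c n) = padic_abs x].
Proof.
have [c ->] := to_Qp_surj x; rewrite to_Qp_eq0.
move=> /cauchy_rat_stationary[l l0 Nl]; exists c.
by rewrite (padic_abs_to_Qp l0 Nl).
Qed.

Lemma padic_abs0 : padic_abs 0 = 0.
Proof.
have [c c0] := to_Qp_surj 0.
by rewrite c0 padic_abs_to_Qp0// -to_Qp_eq0 -c0.
Qed.

Lemma padic_abs_gt0 (x : Qp) : x != 0 -> 0 < padic_abs x.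
Proof. by move=> /padic_absP[c []]. Qed.

Lemma padic_abs_ge0 (x : Qp) : 0 <= padic_abs x.
Proof.
by have [->|/padic_abs_gt0/ltW//] := eqVneq x 0; rewrite padic_abs0.
Qed.

Lemma padic_abs_eq0 (x : Qp) : (padic_abs x == 0) = (x == 0).
Proof.
have [->|x0] := eqVneq x 0; first by rewrite padic_abs0 eqxx.
by rewrite gt_eqF// padic_abs_gt0.
Qed.

Lemma padic_absM (x y : Qp) : padic_abs (x * y) = padic_abs x * padic_abs y.
Proof.
have [->|/padic_absP[c [-> x0 [N HN]]]] := eqVneq x 0.
  by rewrite mul0r padic_abs0 mul0r.
have [->|/padic_absP[d [-> y0 [M HM]]]] := eqVneq y 0.
  by rewrite mulr0 padic_abs0 mulr0.
rewrite -to_QpM; apply: padic_abs_to_Qp; first exact: mulr_gt0.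
exists (maxn N M) => n; rewrite geq_max => /andP[/HN <- /HM <-].
exact: rat_padic_absM.
Qed.

Lemma padic_absD (x y : Qp) :
  padic_abs (x + y) <= Num.max (padic_abs x) (padic_abs y).
Proof.
have [->|/padic_absP[c [xc x0 [N HN]]]] := eqVneq x 0.
  by rewrite add0r le_max lexx orbT.
have [->|/padic_absP[d [yd y0 [M HM]]]] := eqVneq y 0.
  by rewrite addr0 le_max lexx.
have [->|] := eqVneq (x + y) 0.
  by rewrite padic_abs0 le_max (ltW x0).
rewrite xc yd -to_QpD to_Qp_eq0 => /cauchy_rat_stationary[l l0 [K HK]].
rewrite (padic_abs_to_Qp l0); last by exists K.
pose n := maxn K (maxn N M).
have [Kn Nn Mn] : [/\ K <= n, N <= n & M <= n]%N.
  by split; rewrite !leq_max leqnn ?orbT.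
by rewrite -xc -yd -(HK n)// -(HN n)// -(HM n)// rat_padic_absD.
Qed.

Lemma padic_absN (x : Qp) : padic_abs (- x) = padic_abs x.
Proof.
have N1 : padic_abs (-1) = 1.
  apply/eqP; rewrite -(@eqrXn2 _ 2) ?padic_abs_ge0// expr1n expr2 -padic_absM.
  rewrite mulrNN mulr1 -to_Qp1 (@padic_abs_to_Qp _ 1)//.
  by exists 0%N => n _; exact: rat_padic_abs1.
by rewrite -mulN1r padic_absM N1 mul1r.
Qed.

Let padic_dist (x y : Qp) : R := padic_abs (x - y).

Fact padic_distxx x : padic_dist x x = 0.
Proof. by rewrite /padic_dist subrr padic_abs0. Qed.

Fact padic_dist_positivity x y : padic_dist x y = 0 -> x = y.
Proof. by move/eqP; rewrite padic_abs_eq0 subr_eq0 => /eqP. Qed.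

Fact padic_dist_sym x y : padic_dist x y = padic_dist y x.
Proof. by rewrite /padic_dist -padic_absN opprB. Qed.

Fact padic_dist_triangle y x z :
  padic_dist x z <= padic_dist x y + padic_dist y z.
Proof.
rewrite /padic_dist -[x](subrK y) -addrA.
rewrite (le_trans (padic_absD _ _))// ge_max.
by rewrite addrK lerDl lerDr !padic_abs_ge0.
Qed.

HB.instance Definition _ := isMetric.Build R Qp
  padic_distxx padic_dist_positivity padic_dist_sym padic_dist_triangle.
HB.instance Definition _ := isPointed.Build Qp 0.

Let rat_const (q : rat) : cauchy_rat R p_pr.
Proof.
exists (fun=> q); apply/asboolP => e e0; exists 0%N => m n _ _.
by rewrite subrr rat_padic_abs0.
Defined.

Let rat_constE q : to_Qp (rat_const q) = ratr q.
Proof.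
have toM a b : to_Qp (rat_const (a * b)) = to_Qp (rat_const a) * to_Qp (rat_const b).
  by rewrite -to_QpM; congr to_Qp; apply: val_inj.
have toB a b : to_Qp (rat_const (a - b)) = to_Qp (rat_const a) - to_Qp (rat_const b).
  by rewrite -to_QpB; congr to_Qp; apply: val_inj.
have to1 : to_Qp (rat_const 1) = 1 by rewrite -to_Qp1; congr to_Qp; apply: val_inj.
have to0 : to_Qp (rat_const 0) = 0 by rewrite -[0 in LHS](subrr 1) toB subrr.
have toN a : to_Qp (rat_const (- a)) = - to_Qp (rat_const a).
  by rewrite -sub0r toB to0 sub0r.
have ton n : to_Qp (rat_const n%:R) = n%:R.
  elim: n => [//|n IH].
  by rewrite -addn1 natrD -[1%:R]opprK toB toN to1 opprK IH natrD.
have toz (z : int) : to_Qp (rat_const z%:~R) = z%:~R.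
  by case: z => n; rewrite ?NegzE ?mulrNz ?toN ton.
have nz z : z != 0 -> to_Qp (rat_const z) != 0.
  move=> z0; rewrite to_Qp_eq0; apply/asboolP => /(_ (abs z)).
  by rewrite rat_padic_abs_gt0// => /(_ isT)[N /(_ N (leqnn _))]; rewrite ltxx.
rewrite /ratr -{1}[q]divq_num_den toM toz; congr (_ * _).
have d0 : to_Qp (rat_const (denq q)%:~R) != 0 by rewrite nz// intr_eq0 denq_eq0.
by apply: (mulfI d0); rewrite -toM divff ?intr_eq0// to1 -toz divff.
Qed.

Lemma padic_abs_ratr (q : rat) : padic_abs (ratr q) = abs q.
Proof.
rewrite -rat_constE; have [->|q0] := eqVneq q 0.
  rewrite rat_padic_abs0 padic_abs_to_Qp0//; apply/asboolP => e e0.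
  by exists 0%N => n _; rewrite /= rat_padic_abs0.
by apply: padic_abs_to_Qp; [exact: rat_padic_abs_gt0|exists 0%N].
Qed.

Lemma ratr_dense (x : Qp) (e : R) : 0 < e ->
  exists q : rat, padic_abs (x - ratr q) < e.
Proof.
move=> e0; have [c xc] := to_Qp_surj x.
have /asboolP/(_ _ e0)[N HN] := cauchy_seqP c.
exists (c N); rewrite xc -rat_constE -to_QpB.
have [->|] := eqVneq (to_Qp (c - rat_const (c N))) 0; first by rewrite padic_abs0.
rewrite to_Qp_eq0 => /cauchy_rat_stationary[l l0 [M HM]].
rewrite (padic_abs_to_Qp l0); last by exists M.
by rewrite -(HM (maxn N M)) ?leq_maxr// HN ?leq_maxl.
Qed.

End PadicField.

HB.instance Definition _ (R : realType) (p : nat) (p_pr : prime p) :=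
  @isMeasurable.Build (sigma_display (@open (@Qp R p p_pr))) (@Qp R p p_pr)
    <<s open >> (@sigma_algebra0 _ setT open) (@sigma_algebraC _ open)
    (@sigma_algebra_bigcup _ setT open).

Section ComplexIntegral.
Context d (T : measurableType d) (R : realType).
Variable mu : {measure set T -> \bar R}.
Implicit Types (D : set T) (f : T -> R[i]).

Definition cabs (z : R[i]) : R := complex.Re `|z|.

Definition cmeasurable D f :=
  measurable_fun D (fun x => complex.Re (f x)) /\
  measurable_fun D (fun x => complex.Im (f x)).

Definition cintegrable D f :=
  mu.-integrable D (fun x => (complex.Re (f x))%:E) /\
  mu.-integrable D (fun x => (complex.Im (f x))%:E).

Definition cintegral D f : R[i] :=
  Complex (\int[mu]_(x in D) complex.Re (f x))
          (\int[mu]_(x in D) complex.Im (f x)).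

Definition cLnorm (r : R) f : \bar R :=
  Lnorm mu r%:E (fun x => (cabs (f x))%:E).

End ComplexIntegral.

Section Spaces.
Variables (R : realType) (p : nat) (p_pr : prime p).
Local Notation Qp := (@Qp R p p_pr).
Implicit Types (mu : {measure set Qp -> \bar R}) (f b : Qp -> R[i]).

Definition padic_ball (k : int) : set Qp := [set x | padic_abs x <= p%:R ^ k].

Definition padic_sphere (k : int) : set Qp := padic_ball k `\` padic_ball (k - 1).

Record normalized_haar mu : Prop := NormalizedHaar {
  haar_translation : forall (a : Qp) (A : set Qp), measurable A ->
    mu [set a + x | x in A] = mu A;
  haar_unit_ball : mu [set x : Qp | padic_abs x <= 1] = 1%E }.

(* The compact subsets of Qp are the closed bounded ones, so local
   integrability is integrability over every ball B_k. *)
Definition Lloc mu (r : R) f :=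
  cmeasurable [set: Qp] f /\
  forall k, (\int[mu]_(x in padic_ball k) ((cabs (f x)) `^ r)%:E < +oo)%E.

Definition ball_mean mu f (k : int) : R[i] :=
  ((fine (mu (padic_ball k)))^-1)%:C * cintegral mu (padic_ball k) f.

Definition CMO_norm mu (s : R) f : \bar R :=
  ereal_sup [set
    (((fine (mu (padic_ball k)))^-1)%:E *
     \int[mu]_(x in padic_ball k) ((cabs (f x - ball_mean mu f k)) `^ s)%:E)
      `^ s^-1 | k in [set: int]]%E.

Definition CMO mu (s : R) : set (Qp -> R[i]) :=
  [set f | Lloc mu s f /\ (CMO_norm mu s f < +oo)%E].

Definition Herz_norm mu (alpha q r : R) f : \bar R :=
  ((\esum_(k in [set: int])
     ((p%:R `^ (k%:~R * alpha * q))%:E *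
      cLnorm mu r (fun x => (f x * \1_(padic_sphere k) x)%R) `^ q)) `^ q^-1)%E.

Definition Herz mu (alpha q r : R) : set (Qp -> R[i]) :=
  [set f | Lloc mu r f /\ (Herz_norm mu alpha q r f < +oo)%E].

Definition HLP_integrand f (x y : Qp) : R[i] :=
  f y / (Num.max (padic_abs x) (padic_abs y))%:C.

Definition HLP mu f (x : Qp) : R[i] :=
  cintegral mu [set~ 0] (HLP_integrand f x).

(* [cintegral] returns a junk value on non-integrable functions, so [HLP mu f x]
   is meaningful only when the defining integral converges absolutely; this is
   required at almost every x (at x = 0 it may fail for f in a Herz space). *)
Definition HLP_defined mu f :=
  {ae mu, forall x, cintegrable mu [set~ 0] (HLP_integrand f x)}.

Definition HLP_commutator mu b f (x : Qp) : R[i] :=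
  b x * HLP mu f x - HLP mu (fun y => b y * f y) x.

Definition HLP_commutator_defined mu b f :=
  HLP_defined mu f /\ HLP_defined mu (fun y => b y * f y).

(* [dom] is the set of functions on which [A] is well defined. *)
Definition bounded_operator (dom : (Qp -> R[i]) -> Prop)
    (A : (Qp -> R[i]) -> (Qp -> R[i]))
    (X : set (Qp -> R[i])) (normX : (Qp -> R[i]) -> \bar R)
    (Y : set (Qp -> R[i])) (normY : (Qp -> R[i]) -> \bar R) : Prop :=
  exists C : R, forall f, X f ->
    [/\ dom f, Y (A f) & (normY (A f) <= C%:E * normX f)%E].

End Spaces.

(* Main.v *)
Require Import Defs.
From mathcomp Require Import all_boot all_order all_algebra.
From mathcomp Require Import all_classical all_reals all_analysis.
From mathcomp.real_closed Require Import complex.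
From mathcomp Require Import measurable_realfun ring lra zify.
Import Order.TTheory GRing.Theory Num.Theory.
Local Open Scope classical_set_scope.
Local Open Scope complex_scope.
Local Open Scope ring_scope.

(** Let [beta k] be the mean of [b] over the ball [B_k]. The CMO condition gives
    [int_{S_k} (1 + |b - beta k|)^t = O(p^k)] for [t = r, r'] and
    [|beta j - beta k| = O(|j - k|)]. Writing the commutator on the sphere [S_k] as
    [(b x - beta k) Tf(x) - T((b - beta k) f)(x)] and cutting the integrals along
    the spheres [S_j], Hoelder's inequality bounds [p^(-k/r) ||T_b f||_{L^r(S_k)}],
    up to a constant, by
    [sum_j (1 + |j - k|) p^(- max(k, j)) p^(j/r') ||f||_{L^r(S_j)}]. After
    multiplication by weights such as [p^(k alpha)] with [-1/r < alpha < 1/r']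
    this is a convolution with a geometrically decaying kernel, bounded on
    every [l^q], and [l^q1] embeds in [l^q2]. The same estimate with the weight
    [min(1, p^(k a))], [-1/r < a < min(0, alpha)], shows that [T_b f] is locally
    in [L^r] at the origin. *)

(** * Sums over the integers *)

(** Adding a constant to [b] does not change the commutator, and the constant may vary with the
    sphere of [x]; hence only oscillations of [b] about [beta k] matter. The exponent max(r, r')
    pays for two uses of them: r' for Hoelder's inequality in the inner integral over [y], r for the
    norm of the outer factor |b x - beta k| over a sphere. The quantity p^(k/r) p^(-max(k, j))
    p^(j/r') is p^(-(k-j)/r') for j <= k and p^(-(j-k)/r) for k <= j. A weight is admissible when it
    grows strictly more slowly than these two rates, which for p^(k alpha) is the assumed range of
    alpha; part of the strict margin absorbs the linear factor in |j - k|. Nonnegative sums and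
    integrals live in the extended reals, so the estimates come before any finiteness. Finiteness of
    the inner integrals is deduced from them, and only then is linearity of the integral available.
    Finally, for alpha > 0 a finite Herz norm does not imply that a function is locally in L^r at
    the origin, which is why a second weight appears. *)

Lemma le_poweR {R : realType} {r : R} {x y : \bar R} :
  0 <= r -> (0 <= x)%E -> (x <= y)%E -> (x `^ r <= y `^ r)%E.
Proof.
move=> r0 x0 xy; apply: gt0_ler_poweR => //; rewrite in_itv/= leey andbT//.
exact: le_trans xy.
Qed.

Lemma powR_gt1 {R : realType} {a x : R} : 1 < a -> 0 < x -> 1 < a `^ x.
Proof.
move=> a1 x0; have {1}-> : 1 = 1 `^ x by rewrite powR1.
by rewrite gt0_ltr_powR// nnegrE ?ler01// ltW// (lt_trans ltr01).
Qed.

Lemma esumZl_le {R : realType} {I : choiceType} (D : set I) (c : R)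
    (a : I -> \bar R) : 0 <= c -> (forall i, (0 <= a i)%E) ->
  (\esum_(i in D) (c%:E * a i) <= c%:E * \esum_(i in D) a i)%E.
Proof.
move=> c0 a0; apply: ge_ereal_sup => _ [X [finX XD] <-].
rewrite -ge0_mule_fsumr//; apply: lee_wpmul2l; first by rewrite lee_fin.
by apply: esum_ge; exists X.
Qed.

Lemma esumZl {R : realType} {I : choiceType} (D : set I) (c : R)
    (a : I -> \bar R) : 0 < c -> (forall i, (0 <= a i)%E) ->
  (\esum_(i in D) (c%:E * a i) = c%:E * \esum_(i in D) a i)%E.
Proof.
move=> c0 a0; apply/eqP; rewrite eq_le (esumZl_le _ _ _ (ltW c0))//=.
rewrite -lee_pdivlMl//; set e := esum _ _.
rewrite [leLHS](eq_esum (b := fun i => (c^-1%:E * (c%:E * a i))%E)); last first.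
  by move=> i _; rewrite muleA -EFinM mulVf ?gt_eqF// mul1e.
apply: esumZl_le => [|i]; first by rewrite invr_ge0 ltW.
by rewrite mule_ge0// lee_fin ltW.
Qed.

Lemma esum_term_le {R : realType} {I : choiceType} (a : I -> \bar R) j :
  (forall i, (0 <= a i)%E) -> (a j <= \esum_(i in [set: I]) a i)%E.
Proof.
move=> a0; apply: esum_ge; exists [set j].
  by split => //; exact: finite_set1.
by rewrite fsbig_set1.
Qed.

Lemma esum_exchange {R : realType} {I J : choiceType} (a : I -> J -> \bar R) :
  (forall i j, (0 <= a i j)%E) ->
  (\esum_(i in [set: I]) \esum_(j in [set: J]) a i j =
   \esum_(j in [set: J]) \esum_(i in [set: I]) a i j)%E.
Proof.
move=> a0; rewrite !esum_esum//.
rewrite (@reindex_esum _ _ _ ([set: J] `*`` fun=> [set: I]) _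
  (fun x => (x.2, x.1)))//.
split => //= [[x1 x2] [y1 y2] _ _ [-> ->]//|[x y] _].
by exists (y, x).
Qed.

Lemma esum_geom_nat {R : realType} (d : R) : 0 < d < 1 ->
  (\esum_(n in [set: nat]) (d ^+ n)%:E <= ((1 - d)^-1)%:E)%E.
Proof.
move=> /andP[d0 d1]; rewrite -nneseries_esumT; last first.
  by move=> n; rewrite lee_fin exprn_ge0// ltW.
apply: lime_le.
  by apply: is_cvg_nneseries => n _ _; rewrite lee_fin exprn_ge0// ltW.
apply: nearW => n /=; rewrite sumEFin lee_fin big_mkord.
have d10 : 0 < 1 - d by rewrite subr_gt0.
rewrite -[leRHS]mul1r ler_pdivlMr// mulrC.
have -> : (1 - d) * \sum_(i < n) d ^+ i = 1 - d ^+ n.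
  by rewrite -opprB mulNr -subrX1 opprB.
by rewrite lerBlDr lerDl exprn_ge0// ltW.
Qed.

Lemma esum_geom_dist {R : realType} (d : R) : 0 < d < 1 ->
  exists2 A : R, 0 < A &
    forall j : int, (\esum_(k in [set: int]) (d ^+ `|k - j|%N)%:E <= A%:E)%E.
Proof.
move=> d01; have /andP[d0 d1] := d01.
(* One geometric series for k >= j and one for k < j. *)
exists ((1 - d)^-1 + (1 - d)^-1); first by rewrite addr_gt0// invr_gt0 subr_gt0.
move=> j; rewrite (@reindex_esum _ _ _ [set: int] _ (fun k => k + j)); last first.
  split => //= [x y _ _ /addIr//|y _].
  by exists (y - j) => //; rewrite subrK.
have pos n : (0 <= (d ^+ n)%:E)%E by rewrite lee_fin exprn_ge0// ltW.
rewrite (esumID [set Posz n | n in [set: nat]])//.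
rewrite !setTI EFinD; apply: leeD.
  rewrite (@reindex_esum _ _ _ [set: nat] _ Posz); last first.
    by split => //= x y _ _ [].
  by under eq_esum do rewrite addrK; exact: esum_geom_nat.
rewrite (@reindex_esum _ _ _ [set: nat] _ Negz); last first.
  split => [n _ /= [m _]//|x y _ _ []//|[n|n] //= H].
    by exfalso; apply: H; exists n.
  by exists n.
(* [Negz n] is -(n+1), so this half has the terms d^(n+1), each at most d^n. *)
apply: le_trans (esum_geom_nat d d01); apply: le_esum => n _.
rewrite addrK lee_fin (_ : `|Negz n|%N = n.+1)//.
by rewrite exprS ler_piMl ?exprn_ge0// ltW.
Qed.

(* Writing [d ^ (2 n) u = d ^ n (d ^ n u)] and bounding [d ^ n u] by the
   [l^q]-sum of all such terms replaces Young's inequality; unlike the latter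
   it also covers [q < 1]. *)
Lemma geometric_convolution_bound {R : realType} (d q : R) : 0 < d < 1 -> 0 < q ->
  exists2 C : R, 0 < C & forall u v : int -> \bar R,
    (forall j, (0 <= u j)%E) -> (forall k, (0 <= v k)%E) ->
    (forall k, (v k <= \esum_(j in [set: int])
                         ((d ^+ (2 * `|k - j|)%N)%:E * u j))%E) ->
    (\esum_(k in [set: int]) (v k `^ q) <=
     C%:E * \esum_(j in [set: int]) (u j `^ q))%E.
Proof.
move=> d01 q0; have /andP[d0 d1] := d01.
have [A A0 HA] := esum_geom_dist d d01.
have dq : 0 < d `^ q < 1.
  rewrite powR_gt0//=.
  have -> : 1 = 1 `^ q by rewrite powR1.
  by rewrite gt0_ltr_powR// ?nnegrE ltW.
have [B B0 HB] := esum_geom_dist _ dq.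
(* [A] bounds the sum of d^|k-j| left after one factor has been bounded by [X k]; [B] bounds the sum
   of (d^q)^|k-j| over k that appears once the double sum is exchanged. *)
exists (A `^ q * B); first by rewrite mulr_gt0// powR_gt0.
move=> u v u0 v0 vu.
have dn0 n : 0 <= d ^+ n by rewrite exprn_ge0// ltW.
have dqn0 n : 0 <= (d `^ q) ^+ n by rewrite exprn_ge0// powR_ge0.
pose X k := (\esum_(j in [set: int]) (((d `^ q) ^+ `|k - j|%N)%:E * u j `^ q))%E.
have X0 k : (0 <= X k)%E.
  by apply: esum_ge0 => j _; rewrite mule_ge0 ?lee_fin ?poweR_ge0.
have dX k j : ((d ^+ `|k - j|%N)%:E * u j <= X k `^ q^-1)%E.
  have -> : ((d ^+ `|k - j|%N)%:E * u j =
      (((d `^ q) ^+ `|k - j|%N)%:E * u j `^ q) `^ q^-1)%E.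
    rewrite poweRM ?lee_fin ?poweR_ge0// -poweRrM divff ?gt_eqF// poweRe1//.
    rewrite poweR_EFin; congr (_%:E * _)%E.
    rewrite -(powR_mulrn _ (powR_ge0 d q)) -!powRrM -powR_mulrn ?ltW//.
    by congr powR; field; rewrite gt_eqF.
  apply: le_poweR; first by rewrite invr_ge0 ltW.
    by rewrite mule_ge0 ?lee_fin ?poweR_ge0.
  apply: (esum_term_le (fun j => ((d `^ q) ^+ `|k - j|%N)%:E * u j `^ q)%E j).
  by move=> i; rewrite mule_ge0 ?lee_fin ?poweR_ge0.
have vX k : (v k `^ q <= (A `^ q)%:E * X k)%E.
  have : (v k <= A%:E * X k `^ q^-1)%E.
    apply: (le_trans (vu k)).
    have /le_trans -> // :
        (\esum_(j in [set: int]) ((d ^+ (2 * `|k - j|)%N)%:E * u j) <=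
         \esum_(j in [set: int]) (X k `^ q^-1 * (d ^+ `|j - k|%N)%:E))%E.
      apply: le_esum => j _; rewrite mul2n -addnn exprD EFinM -muleA muleC.
      by rewrite distnC lee_wpmul2r// ?lee_fin// distnC.
    have := poweR_ge0 (X k) q^-1; case: (X k `^ q^-1)%E => [x||]//.
      rewrite lee_fin => x0; apply: le_trans (esumZl_le _ _ _ x0 _) _.
        by move=> j; rewrite lee_fin.
      by rewrite muleC lee_wpmul2r// lee_fin.
    by move=> _; rewrite gt0_muley ?lte_fin// leey.
  move=> /(le_poweR (ltW q0) (v0 k))/le_trans; apply.
  rewrite poweRM ?poweR_ge0 ?lee_fin ?(ltW A0)// -poweRrM mulVf ?gt_eqF//.
  by rewrite poweRe1// poweR_EFin.
apply: (@le_trans _ _ (\esum_(k in [set: int]) ((A `^ q)%:E * X k))%E).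
  exact: le_esum.
apply: le_trans (esumZl_le _ _ _ _ _) _ => //; first exact: powR_ge0.
rewrite EFinM -muleA lee_wpmul2l ?lee_fin ?powR_ge0// /X esum_exchange; last first.
  by move=> i j; rewrite mule_ge0 ?lee_fin ?poweR_ge0.
apply: (@le_trans _ _ (\esum_(j in [set: int]) (B%:E * u j `^ q))%E).
  apply: le_esum => j _.
  have uq0 := poweR_ge0 (u j) q.
  have [->|uj0] := eqVneq (u j `^ q)%E 0%E.
    by under eq_esum do rewrite mule0; rewrite mule0 esum1.
  case: (u j `^ q)%E uj0 uq0 => [x||]//; last first.
    by move=> _ _; rewrite gt0_muley ?lte_fin// leey.
  rewrite lee_fin => _ x0; under eq_esum do rewrite muleC.
  apply: le_trans (esumZl_le _ _ _ x0 _) _.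
    by move=> k; rewrite lee_fin.
  rewrite muleC.
  by rewrite lee_wpmul2r// ?lee_fin.
by apply: esumZl_le; rewrite ?ltW// => j; exact: poweR_ge0.
Qed.

(** With S the sum of the u_i^q1, each u_i^q1 is at most S, so u_i^q2 <= S^(q2/q1 - 1) u_i^q1;
    summing gives S^(q2/q1). Only an infinite S needs a separate word. *)
Lemma esum_poweR_le {R : realType} {I : choiceType} (q1 q2 : R)
    (u : I -> \bar R) : 0 < q1 -> q1 <= q2 -> (forall i, (0 <= u i)%E) ->
  ((\esum_(i in [set: I]) (u i `^ q2)) `^ q2^-1 <=
   (\esum_(i in [set: I]) (u i `^ q1)) `^ q1^-1)%E.
Proof.
move=> q10 q12 u0; have q20 := lt_le_trans q10 q12.
set S := (\esum_(i in [set: I]) (u i `^ q1))%E.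
have S0 : (0 <= S)%E by apply: esum_ge0 => i _; exact: poweR_ge0.
have [Sy|Sfin] := eqVneq S +oo%E.
  by rewrite Sy poweRyr ?leey// invr_neq0// gt_eqF.
have [s Ss] : exists s, S = s%:E.
  by move: S0 Sfin; case: S => // s _ _; exists s.
have s0 : 0 <= s by rewrite -lee_fin -Ss.
have uS i : (u i `^ q2 <= (s `^ (q2 / q1 - 1))%:E * u i `^ q1)%E.
  have : (u i `^ q1 <= s%:E)%E.
    by rewrite -Ss; apply: (esum_term_le (fun i => u i `^ q1)%E) => k; exact: poweR_ge0.
  have [->|ui0] := eqVneq (u i) 0%E.
    by rewrite !poweR0r ?gt_eqF// mule0.
  have : (0 < u i)%E by rewrite lt0e ui0 u0.
  case: (u i) => [x||]//; last by rewrite poweRyr ?gt_eqF.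
  rewrite lte_fin !poweR_EFin -EFinM !lee_fin => x0 xs.
  have -> : x `^ q2 = (x `^ q1) `^ (q2 / q1 - 1) * x `^ q1.
    rewrite -powRrM -powRD; last by rewrite (gt_eqF x0) implybT.
    by congr powR; field; rewrite gt_eqF.
  rewrite ler_wpM2r ?powR_ge0// ge0_ler_powR// ?nnegrE ?powR_ge0//.
  by rewrite subr_ge0 ler_pdivlMr// mul1r.
have : (\esum_(i in [set: I]) (u i `^ q2) <= (s `^ (q2 / q1))%:E)%E.
  apply: (@le_trans _ _ (\esum_(i in [set: I])
      ((s `^ (q2 / q1 - 1))%:E * u i `^ q1))%E); first exact: le_esum.
  apply: le_trans (esumZl_le _ _ _ _ _) _ => //; first exact: powR_ge0.
    by move=> i; exact: poweR_ge0.
  rewrite -/S Ss -EFinM lee_fin.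
  have [->|sn0] := eqVneq s 0; first by rewrite mulr0 powR_ge0.
  rewrite -{2}(powRr1 s0) -powRD ?subrK ?sn0 ?implybT//.
move=> /(@le_poweR _ q2^-1)/le_trans; apply; first by rewrite invr_ge0 ltW.
  by apply: esum_ge0 => i _; exact: poweR_ge0.
rewrite Ss !poweR_EFin -powRrM lee_fin.
by rewrite mulrAC divff ?gt_eqF// mul1r.
Qed.

(** Bernoulli's inequality d^(-n) >= 1 + n c with c = 1/d - 1, multiplied by 2 + K/c, dominates 2 +
    K n. *)
Lemma linear_times_geometric_bound {R : realType} (K d : R) : 0 <= K -> 0 < d < 1 ->
  exists2 C : R, 0 < C & forall n : nat, (2 + K * n%:R) * d ^+ n <= C.
Proof.
move=> K0 /andP[d0 d1]; pose c := d^-1 - 1.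
have c0 : 0 < c by rewrite subr_gt0 invf_gt1.
exists (2 + K / c).
  by rewrite ltr_pwDl// divr_ge0// ltW.
move=> n; have B : 1 + n%:R * c <= d^-1 ^+ n.
  elim: n => [|n IH]; first by rewrite mul0r addr0 expr0.
  rewrite exprS; apply: le_trans (_ : d^-1 * (1 + n%:R * c) <= _).
    have -> : d^-1 = 1 + c by rewrite /c; ring.
    rewrite -natr1; have : 0 <= n%:R * c * c by rewrite !mulr_ge0// ltW.
    by nra.
  by rewrite ler_wpM2l// invr_ge0 ltW.
rewrite -ler_pdivlMr ?exprn_gt0// -exprVn.
apply: le_trans (_ : (2 + K / c) * (1 + n%:R * c) <= _).
  have -> : (2 + K / c) * (1 + n%:R * c) =
     2 + K * n%:R + (2 * n%:R * c + K / c) by field; rewrite gt_eqF.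
  by rewrite lerDl addr_ge0// ?divr_ge0// ?mulr_ge0// ltW.
by rewrite ler_wpM2l// addr_ge0// divr_ge0// ltW.
Qed.

(** Because x + y = 1, the powers of [P] other than the weight combine to P^(-(k-j) y) for j <= k
    and to P^(-(j-k) x) for k <= j. The two growth conditions on [W] leave a decay P^(-n eps) with n
    = |k - j|. *)
Lemma weighted_kernel_bound {R : realType} (P K x y eps : R) (W : int -> R) :
  1 < P -> 0 <= K -> 0 < eps -> x + y = 1 -> (forall k, 0 < W k) ->
  (forall j k : int, j <= k -> W k <= W j * P `^ ((k - j)%:~R * (y - eps))) ->
  (forall j k : int, k <= j -> W k <= W j * P `^ ((j - k)%:~R * (x - eps))) ->
  exists2 d : R, 0 < d < 1 & exists2 C : R, 0 < C & forall k j : int,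
    W k * (P `^ (k%:~R * x) * ((2 + K * `|k - j|%N%:R) *
       (P ^ (Num.max k j))^-1 * P `^ (j%:~R * y))) <=
    C * (d ^+ (2 * `|k - j|)%N * W j).
Proof.
move=> P1 K0 eps0 xy W0 Wl Wr; have P0 : 0 < P := lt_trans ltr01 P1.
(* With this choice P^(-n eps) = d^(2n) d^(2n): one factor absorbs 2 + K n, the other is the kernel
   required by [geometric_convolution_bound]. *)
pose d := P `^ (- (eps / 4)).
have d0 : 0 < d by exact: powR_gt0.
have d01 : 0 < d < 1.
  by rewrite d0 /d powRN invf_lt1 ?powR_gt0//= powR_gt1// divr_gt0.
have d201 : 0 < d ^+ 2 < 1.
  by rewrite exprn_gt0//= exprn_ilt1 ?ltW//; case/andP: d01.
have [C C0 HC] := linear_times_geometric_bound K (d ^+ 2) K0 d201.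
exists d => //; exists C => // k j; set n := `|k - j|%N.
suff H : W k * (P `^ (k%:~R * x) * ((P ^ (Num.max k j))^-1 * P `^ (j%:~R * y))) <=
    W j * P `^ (- (n%:R * eps)).
  have -> : W k * (P `^ (k%:~R * x) * ((2 + K * n%:R) *
       (P ^ (Num.max k j))^-1 * P `^ (j%:~R * y))) =
     (2 + K * n%:R) * (W k * (P `^ (k%:~R * x) * ((P ^ (Num.max k j))^-1 * P `^ (j%:~R * y)))).
    by ring.
  apply: le_trans (_ : (2 + K * n%:R) * (W j * P `^ (- (n%:R * eps))) <= _).
    by rewrite ler_wpM2l// addr_ge0// mulr_ge0.
  have -> : P `^ (- (n%:R * eps)) = d ^+ (2 * n) * d ^+ (2 * n).
    rewrite -exprD -powR_mulrn ?ltW// -powRrM; congr powR.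
    by rewrite -mulnDl natrM; field.
  have -> : (2 + K * n%:R) * (W j * (d ^+ (2 * n) * d ^+ (2 * n))) =
      (2 + K * n%:R) * (d ^+ 2) ^+ n * (d ^+ (2 * n) * W j).
    by rewrite -exprM; ring.
  by rewrite ler_wpM2r// mulr_ge0 ?exprn_ge0 ?ltW.
have [jk|/ltW kj] := leP j k.
  have nE : n%:R = (k - j)%:~R :> R by rewrite -[LHS]/(n%:~R) gez0_abs// subr_ge0.
  apply: le_trans (_ : (W j * P `^ ((k - j)%:~R * (y - eps))) *
      (P `^ (k%:~R * x) * ((P ^ k)^-1 * P `^ (j%:~R * y))) <= _).
    by rewrite ler_wpM2r ?Wl// !mulr_ge0 ?powR_ge0// invr_ge0 exprz_ge0// ltW.
  rewrite -mulrA ler_wpM2l ?(ltW (W0 _))// -powR_intmul ?(ltW P0)// -powRN.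
  rewrite -!powRD ?(gt_eqF P0) ?implybT// nE.
  apply: ler_powR; first exact: ltW.
  have {}xy : y = 1 - x by rewrite -xy addrAC subrr add0r.
  by rewrite xy intrB; nra.
have nE : n%:R = (j - k)%:~R :> R.
  by rewrite /n distnC -[LHS]/(`|j - k|%N%:~R) gez0_abs// subr_ge0.
apply: le_trans (_ : (W j * P `^ ((j - k)%:~R * (x - eps))) *
    (P `^ (k%:~R * x) * ((P ^ j)^-1 * P `^ (j%:~R * y))) <= _).
  by rewrite ler_wpM2r ?Wr// !mulr_ge0 ?powR_ge0// invr_ge0 exprz_ge0// ltW.
rewrite -mulrA ler_wpM2l ?(ltW (W0 _))// -powR_intmul ?(ltW P0)// -powRN.
rewrite -!powRD ?(gt_eqF P0) ?implybT// nE.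
  apply: ler_powR; first exact: ltW.
have {}xy : y = 1 - x by rewrite -xy addrAC subrr add0r.
by rewrite xy intrB; nra.
Qed.

(** * Spheres and Haar measure *)

Lemma prime_gt1r {R : realType} {p : nat} : prime p -> 1 < p%:R :> R.
Proof. by move=> p_pr; rewrite ltr1n prime_gt1. Qed.

Lemma prime_gt0r {R : realType} {p : nat} : prime p -> 0 < p%:R :> R.
Proof. by move=> p_pr; rewrite ltr0n prime_gt0. Qed.

Section PadicSpheres.
Context {R : realType} {p : nat} {p_pr : prime p}.
Local Notation Qp := (@Qp R p p_pr).
Local Notation P := (p%:R : R).
Implicit Types (x y : Qp) (k : int).

Lemma padic_abs_expz x : x != 0 -> exists k, padic_abs x = P ^ k.
Proof.
move=> /padic_absP[c [_ x0 [N HN]]]; have := HN N (leqnn N).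
rewrite /rat_padic_abs; case: eqP => [_ x00|_ <-]; last by eexists.
by move: x0; rewrite -x00 ltxx.
Qed.

Lemma padic_sphereP k x : padic_sphere k x <-> padic_abs x = P ^ k.
Proof.
split=> [[/= xk /negP]|xk].
  rewrite -ltNge => kx.
  have x0 : x != 0.
    by rewrite -padic_abs_eq0 gt_eqF// (le_lt_trans _ kx)// exprz_ge0// ler0n.
  have [m xm] := padic_abs_expz x x0; move: xk kx; rewrite /padic_ball/= xm.
  rewrite ler_eXz2l ?ltr_eXz2l ?(prime_gt1r p_pr)// => mk km.
  by congr (_ ^ _); apply/eqP; lia.
rewrite /padic_sphere /padic_ball; split => /=; first by rewrite xk.
by apply/negP; rewrite xk -ltNge ltr_eXz2l ?(prime_gt1r p_pr)//; lia.
Qed.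

Lemma open_padic_ball k : open (padic_ball k : set Qp).
Proof.
rewrite openE => x /= xk.
apply/nbhs_ballP; exists (P ^ k); first by rewrite /= exprz_gt0// (prime_gt0r p_pr).
move=> y; rewrite /ball/= => xy.
rewrite /padic_ball/= -[y](subrK x) (le_trans (padic_absD _ _))// ge_max xk andbT.
by rewrite -padic_absN opprB ltW.
Qed.

Lemma measurable_padic_ball k : measurable (padic_ball k : set Qp).
Proof. by apply: sub_sigma_algebra; exact: open_padic_ball. Qed.

Lemma measurable_padic_sphere k : measurable (padic_sphere k : set Qp).
Proof. by apply: measurableD; exact: measurable_padic_ball. Qed.

Lemma bigcup_padic_sphere : \bigcup_k (padic_sphere k) = [set~ 0] :> set Qp.
Proof.
apply/seteqP; split=> [x [k _ /padic_sphereP xk] /= x0|x /eqP x0].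
  have := exprz_gt0 k (prime_gt0r p_pr : 0 < P).
  by rewrite -xk x0 padic_abs0 ltxx.
by have [k xk] := padic_abs_expz x x0; exists k => //; exact/padic_sphereP.
Qed.

Lemma measurable_padic_setC0 : measurable ([set~ 0] : set Qp).
Proof.
rewrite -bigcup_padic_sphere; apply: countable_bigcupT_measurable.
  exact: countableP.
exact: measurable_padic_sphere.
Qed.

Lemma measurable_padic_set0 : measurable ([set 0] : set Qp).
Proof.
rewrite -(setCK [set 0]); apply: measurableC.
exact: measurable_padic_setC0.
Qed.

(** The norm takes countably many values and its level sets, the spheres and {0}, are measurable;
    every function of the norm is therefore measurable, whatever [h] is. *)
Lemma measurable_fun_padic_abs d (T : measurableType d) (h : R -> T) :
  measurable_fun [set: Qp] (fun x => h (padic_abs x)).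
Proof.
move=> _ Y _; rewrite setTI.
have -> : (fun x : Qp => h (padic_abs x)) @^-1` Y =
    \bigcup_k (if `[< Y (h (P ^ k)) >] then padic_sphere k else set0) `|`
    (if `[< Y (h 0) >] then [set 0] else set0).
  apply/seteqP; split=> x /=.
    move=> Yx; have [x0|x0] := eqVneq x 0.
      by right; move: Yx; rewrite x0 padic_abs0 => /asboolP ->.
    have [k xk] := padic_abs_expz x x0; left; exists k => //.
    by move: Yx; rewrite xk => /asboolP ->; exact/padic_sphereP.
  move=> [[k _]|]; case: asboolP => // Yk.
    by move=> /padic_sphereP ->.
  by move=> ->; rewrite padic_abs0.
apply: measurableU; last by case: ifP => _ //; exact: measurable_padic_set0.
apply: countable_bigcupT_measurable; first exact: countableP.
by move=> k; case: ifP => _ //; exact: measurable_padic_sphere.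
Qed.

End PadicSpheres.

(** * Haar measure of balls and integration over spheres *)

Section HaarMeasure.
Context {R : realType} {p : nat} {p_pr : prime p}.
Local Notation Qp := (@Qp R p p_pr).
Local Notation P := (p%:R : R).
Variables (mu : {measure set Qp -> \bar R}) (mu_haar : normalized_haar mu).
Implicit Types (x y : Qp) (k : int).

Lemma padic_abs_natr n : (0 < n)%N -> padic_abs (n%:R : Qp) = P ^ (- (logn p n)%:Z).
Proof.
move=> n0; have := padic_abs_ratr R p_pr n%:R; rewrite ratr_nat => ->.
have -> : n%:R = n%:Z%:Q / 1%:Q :> rat by rewrite divr1.
rewrite rat_padic_abs_frac//; last by rewrite eqz_nat -lt0n.
by rewrite logn1 sub0r.
Qed.

Lemma padic_abs_primeXz k : padic_abs ((p%:R : Qp) ^ k) = P ^ (- k).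
Proof.
have pp : padic_abs (p%:R : Qp) = P^-1.
  by rewrite padic_abs_natr ?prime_gt0// logn_prime// eqxx.
have p0 : (p%:R : Qp) != 0.
  by rewrite -padic_abs_eq0 pp invr_eq0 gt_eqF// (prime_gt0r p_pr).
have pn n : padic_abs ((p%:R : Qp) ^+ n) = P ^- n.
  elim: n => [|n IH].
    by rewrite !expr0 invr1 (_ : 1 = 1%:R :> Qp)// padic_abs_natr// logn1.
  by rewrite exprS padic_absM IH pp exprS invfM.
have abs1 : padic_abs (1 : Qp) = 1 by have := pn 0%N; rewrite !expr0 invr1.
case: k => n; first by rewrite -exprnN -pn.
rewrite NegzE opprK; apply: (mulfI (x := P ^- n.+1)).
  by rewrite invr_eq0 expf_neq0// gt_eqF// (prime_gt0r p_pr).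
rewrite -{1}pn -padic_absM -exprnN divff ?expf_neq0// abs1.
by rewrite mulVf// expf_neq0// gt_eqF// (prime_gt0r p_pr).
Qed.

Lemma padic_abs_int_le1 (z : int) : padic_abs (z%:~R : Qp) <= 1.
Proof.
have natr_le1 n : padic_abs (n%:R : Qp) <= 1.
  case: n => [|n]; first by rewrite padic_abs0 ler01.
  rewrite padic_abs_natr// -[leRHS](expr0z P) ler_eXz2l ?(prime_gt1r p_pr)//.
case: z => n; first exact: natr_le1.
by rewrite NegzE mulrNz padic_absN; exact: natr_le1.
Qed.

Lemma padic_abs_nat_coprime n : (0 < n)%N -> ~~ (p %| n)%N -> padic_abs (n%:R : Qp) = 1.
Proof.
move=> n0 pn; rewrite padic_abs_natr// -[RHS](expr0z P); congr (_ ^ _).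
apply/eqP; rewrite oppr_eq0 eqz_nat; apply/eqP/eqP; rewrite -leqn0 leqNgt.
by rewrite logn_gt0 mem_primes (negbTE pn) !andbF.
Qed.

Lemma padic_abs_lt_expz x k : padic_abs x < P ^ k -> padic_abs x <= P ^ (k - 1).
Proof.
have [->|x0] := eqVneq x 0.
  by move=> _; rewrite padic_abs0 ltW// exprz_gt0// (prime_gt0r p_pr).
have [m ->] := padic_abs_expz x x0.
by rewrite ltr_eXz2l ?ler_eXz2l ?(prime_gt1r p_pr)//; lia.
Qed.

Lemma translate_padic_ball (a : Qp) k :
  [set a + x | x in padic_ball k] = [set x : Qp | padic_abs (x - a) <= P ^ k].
Proof.
apply/seteqP; split=> [_ [x xk <-]|x xk] /=; first by rewrite addrAC subrr add0r.
by exists (x - a) => //; rewrite addrC subrK.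
Qed.

Lemma measurable_translate_padic_ball (a : Qp) k :
  measurable [set a + x | x in padic_ball k].
Proof.
rewrite translate_padic_ball; apply: sub_sigma_algebra; rewrite openE => x /= xk.
apply/nbhs_ballP; exists (P ^ k); first by rewrite /= exprz_gt0// (prime_gt0r p_pr).
move=> y; rewrite /ball/= => xy.
rewrite -[y](subrK x) -addrA (le_trans (padic_absD _ _))// ge_max xk andbT.
by rewrite -padic_absN opprB ltW.
Qed.

(** The residue field is Z/p. A rational q within distance less than 1 of x has a denominator prime
    to p, and a Bezout relation u denq(q) + v p = 1 makes i = u numq(q) mod p satisfy numq(q) = i
    denq(q) modulo p. *)
Lemma padic_residue x : padic_abs x <= 1 ->
  exists2 i, (i < p)%N & padic_abs (x - i%:R) < 1.
Proof.
move=> x1; have [q xq] := ratr_dense x ltr01.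
have q1 : padic_abs (ratr q : Qp) <= 1.
  rewrite -[ratr q](subrK x) (le_trans (padic_absD _ _))// ge_max x1 andbT.
  by rewrite -padic_absN opprB ltW.
have dp : ~~ (p %| `|denq q|)%N.
  apply/negP => pd; move: q1; apply/negP; rewrite -ltNge padic_abs_ratr.
  have pn : ~~ (p %| `|numq q|)%N.
    apply/negP => pn; have := coprime_num_den q.
    rewrite /coprime => /eqP nd; have : (p %| 1)%N by rewrite -nd dvdn_gcd pn.
    by rewrite dvdn1 => /eqP p1; move: p_pr; rewrite p1.
  have q0 : q != 0 by apply: contraNneq pn => ->; rewrite dvdn0.
  rewrite /rat_padic_abs (negbTE q0) -[ltLHS](expr0z P) ltr_eXz2l ?(prime_gt1r p_pr)//.
  rewrite (_ : logn p `|numq q| = 0)%N; last first.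
    by apply/eqP; rewrite -leqn0 leqNgt logn_gt0 mem_primes (negbTE pn) !andbF.
  by rewrite subr0 ltz_nat logn_gt0 mem_primes p_pr pd absz_gt0 denq_neq0.
have : coprimez (denq q) p by rewrite coprimezE coprime_sym prime_coprime.
move=> /coprimezP[[u v] /= uv].
pose m := u * numq q; pose i := (m %% p)%Z.
have p0 : (p : int) != 0 by rewrite eqz_nat -lt0n prime_gt0.
have i0 : 0 <= i by exact: modz_ge0.
exists `|i|%N.
  by rewrite -ltz_nat gez0_abs// ltz_pmod// ltz_nat prime_gt0.
rewrite -[x](subrK (ratr q)) -addrA (le_lt_trans (padic_absD _ _))// gt_max xq/=.
have d1 : padic_abs ((denq q)%:~R : Qp) = 1.
  rewrite -[denq q]gez0_abs ?denq_ge0//; apply: padic_abs_nat_coprime => //.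
  by rewrite absz_gt0 denq_neq0.
have d0 : (denq q)%:~R != 0 :> Qp by rewrite -padic_abs_eq0 d1 oner_eq0.
rewrite -[ltLHS]mulr1 -d1 -padic_absM mulrBl.
have -> : ratr q * (denq q)%:~R = (numq q)%:~R :> Qp by rewrite /ratr divfK.
have -> : `|i|%N%:R = i%:~R :> Qp by rewrite -[in RHS](gez0_abs i0).
have -> : (numq q)%:~R - i%:~R * (denq q)%:~R =
    (p%:R * ((numq q) * v + (m %/ p)%Z * denq q)%:~R) :> Qp.
  rewrite -[p%:R]/((p : int)%:~R) -!intrM -intrB; congr (_%:~R).
  have -> : i = m - (m %/ p)%Z * p by apply/eqP; rewrite eq_sym subr_eq addrC -divz_eq.
  rewrite -[numq q in LHS]mulr1 -uv /m; ring.
rewrite padic_absM (_ : padic_abs p%:R = P^-1); last by have := padic_abs_primeXz 1.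
apply: (@le_lt_trans _ _ P^-1).
  by rewrite ler_piMr ?padic_abs_int_le1// invr_ge0 ltW// (prime_gt0r p_pr).
by rewrite d1 invf_lt1 ?(prime_gt1r p_pr)// (prime_gt0r p_pr).
Qed.

(** Multiplication by p^k carries B_k to the unit ball, where [padic_residue] gives the
    representatives 0, ..., p - 1; norms being powers of p, a distance smaller than p^k is at most
    p^(k-1). *)
Lemma padic_ball_cosets k : padic_ball k =
  \bigcup_(i in `I_p) [set i%:R * p%:R ^ (- k) + x | x in padic_ball (k - 1)] :> set Qp.
Proof.
have p0 := prime_gt0r p_pr : 0 < P.
have absp j : padic_abs ((p%:R : Qp) ^ j) = P ^ (- j) := padic_abs_primeXz j.
have pk0 j : (p%:R : Qp) ^ j != 0 by rewrite -padic_abs_eq0 absp gt_eqF// exprz_gt0.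
apply/seteqP; split=> [x xk|_ [i _ [x xk <-]]]; rewrite /padic_ball/= in xk *.
  have [|i ip xi] := padic_residue (x * p%:R ^ k).
    rewrite padic_absM absp (le_trans (ler_wpM2r _ xk)) ?exprz_ge0 ?(ltW p0)//.
    by rewrite -expfzDr ?gt_eqF// subrr expr0z.
  exists i => //; exists (x - i%:R * p%:R ^ (- k)); last by rewrite addrC subrK.
  apply: padic_abs_lt_expz.
  have -> : x - i%:R * p%:R ^ (- k) = (x * p%:R ^ k - i%:R) * p%:R ^ (- k) :> Qp.
    by rewrite mulrBl -mulrA -expfzDr ?subrr ?expr0z ?mulr1// (pk0 1).
  by rewrite padic_absM absp opprK -ltr_pdivlMr ?exprz_gt0// divff// gt_eqF// exprz_gt0.
rewrite (le_trans (padic_absD _ _))// ge_max padic_absM absp opprK.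
apply/andP; split; last by rewrite (le_trans xk)// ler_eXz2l ?(prime_gt1r p_pr)//; lia.
by rewrite ler_piMl ?exprz_ge0 ?(ltW p0)// (padic_abs_int_le1 i).
Qed.

(** Two representatives differ by (i - j) p^(-k) with 0 < i - j < p, of norm exactly p^k, whereas
    two points of a coset of B_(k-1) are at distance at most p^(k-1). *)
Lemma trivIset_padic_cosets k : trivIset `I_p
  (fun i => [set i%:R * p%:R ^ (- k) + x | x in (padic_ball (k - 1) : set Qp)]).
Proof.
have p0 := prime_gt0r p_pr : 0 < P.
suff H i j : (j < i < p)%N ->
    [set i%:R * p%:R ^ (- k) + x | x in padic_ball (k - 1)] `&`
    [set j%:R * p%:R ^ (- k) + x | x in padic_ball (k - 1)] = set0 :> set Qp.
  move=> i j /= ip jp; case: (ltngtP i j) => // ij.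
    by rewrite setIC H ?ij// => -[].
  by rewrite H ?ij// => -[].
move=> /andP[ji ip]; rewrite !translate_padic_ball -subset0 => x [/= xi xj].
have := padic_absD (x - j%:R * p%:R ^ (- k)) (- (x - i%:R * p%:R ^ (- k))).
have -> : x - j%:R * p%:R ^ (- k) - (x - i%:R * p%:R ^ (- k)) =
  (i - j)%N%:R * p%:R ^ (- k) :> Qp by rewrite natrB ?(ltnW ji)//; ring.
rewrite padic_absM padic_abs_primeXz opprK padic_abs_nat_coprime ?subn_gt0//; last first.
  by rewrite gtnNdvd ?subn_gt0// (leq_ltn_trans (leq_subr _ _)).
apply/negP; rewrite -ltNge mul1r gt_max padic_absN.
have Pk : P ^ (k - 1) < P ^ k by rewrite ltr_eXz2l ?(prime_gt1r p_pr)//; lia.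
by rewrite !(le_lt_trans _ Pk).
Qed.

Lemma haar_padic_ball_rec k : mu (padic_ball k) = (P%:E * mu (padic_ball (k - 1)))%E.
Proof.
rewrite padic_ball_cosets measure_fin_bigcup//.
- rewrite (eq_fsbigr (fun=> mu (padic_ball (k - 1)))); last first.
    move=> i _; apply: (haar_translation mu_haar).
    exact: measurable_padic_ball.
  rewrite -(fsbig_ord _ _ (fun=> mu (padic_ball (k - 1)))) sumr_const card_ord.
  exact: esym (mule_natl _ _).
- exact: trivIset_padic_cosets.
- by move=> i _; exact: measurable_translate_padic_ball.
Qed.

Lemma haar_padic_ball k : mu (padic_ball k) = (P ^ k)%:E.
Proof.
have p0 := prime_gt0r p_pr : 0 < P.
case: k => n.
  elim: n => [|n IH]; first exact: (haar_unit_ball mu_haar).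
  rewrite haar_padic_ball_rec (_ : n.+1%:Z - 1 = n%:Z); last by lia.
  by rewrite IH -EFinM -exprS.
have cancel (x y : \bar R) : y = (P%:E * x)%E -> x = (P^-1%:E * y)%E.
  by move=> ->; rewrite muleA -EFinM mulVf ?mul1e// gt_eqF.
elim: n => [|n IH].
  rewrite (_ : Negz 0 = 0 - 1)//; rewrite (cancel _ _ (haar_padic_ball_rec 0)).
  by rewrite (haar_unit_ball mu_haar) mule1.
rewrite (_ : Negz n.+1 = Negz n - 1); last by lia.
rewrite (cancel _ _ (haar_padic_ball_rec (Negz n))) IH -EFinM; congr EFin.
by rewrite (_ : Negz n - 1 = Negz n.+1); [rewrite /exprz -invfM -exprS|lia].
Qed.

Lemma haar_set0 : mu [set 0] = 0%E.
Proof.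
apply/eqP; rewrite eq_le measure_ge0 andbT; apply/lee_addgt0Pr => e e0; rewrite add0e.
(* {0} lies in every ball B_(-n), of measure p^(-n); any n above 1/e will do, since n < p^n. *)
have [n Hn] : exists n : nat, P ^- n <= e.
  exists (Num.bound e^-1); rewrite -natrX -[leRHS]invrK lef_pV2 ?posrE ?invr_gt0//.
    rewrite ltW// (lt_le_trans (archi_boundP _)) ?invr_ge0 ?(ltW e0)//.
    by rewrite ler_nat ltnW// ltn_expl// prime_gt1.
  by rewrite ltr0n expn_gt0 prime_gt0.
apply: (@le_trans _ _ (mu (padic_ball (- n%:Z)))).
  apply: le_measure; rewrite ?inE.
  - exact: measurable_padic_set0.
  - exact: measurable_padic_ball.
  - by move=> x ->; rewrite /padic_ball/= padic_abs0 exprz_ge0// ltW// (prime_gt0r p_pr).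
by rewrite haar_padic_ball -exprnN lee_fin.
Qed.

Lemma trivIset_padic_sphere : trivIset [set: int] (fun k => padic_sphere k : set Qp).
Proof.
move=> i j _ _ [x [/padic_sphereP xi /padic_sphereP xj]].
move: xi; rewrite xj => /esym.
by apply: ieexprIz; rewrite ?gt_eqF ?(prime_gt1r p_pr) ?(prime_gt0r p_pr).
Qed.

Lemma integral_padic_setC0 (h : Qp -> \bar R) : measurable_fun [set: Qp] h ->
  (forall x, (0 <= h x)%E) ->
  (\int[mu]_(x in [set~ 0%R]) h x =
   \esum_(k in [set: int]) \int[mu]_(x in padic_sphere k) h x)%E.
Proof.
move=> mh h0.
(* Countable additivity is applied along an enumeration [e] of the integers by the naturals. *)
have [e [e' ee' e'e]] : exists e : nat -> int, bijective e.
  have /card_set_bijP[f] : ([set: int] #= [set: nat])%card.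
    apply: eq_card_nat; first exact: countableP.
    apply: (@sub_infinite_set _ (range Posz)) => //.
    rewrite (eq_finite_set (inj_card_eq _)); first exact: infinite_nat.
    by move=> ? ? _ _ [].
  rewrite setTT_bijective => -[e fe ef]; exists e; exact: (Bijective ef fe).
have ebij : set_bij [set: nat] [set: int] e.
  by rewrite setTT_bijective; exact: (Bijective ee' e'e).
rewrite (reindex_esum _ _ _ _ ebij) -nneseries_esumT; last by move=> n; exact: integral_ge0.
have -> : [set~ 0%R] = \bigcup_n padic_sphere (e n) :> set Qp.
  rewrite -bigcup_padic_sphere; apply/seteqP; split=> x [k _ xk]; last by exists (e k).
  by exists (e' k) => //; rewrite e'e.
apply: ge0_integral_bigcup => //.
- by move=> n; exact: measurable_padic_sphere.
- exact: measurable_funTS.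
- move=> i j _ _ ij; apply: (bij_inj (Bijective ee' e'e)).
  exact: (trivIset_padic_sphere _ _ Logic.I Logic.I ij).
Qed.

Lemma integral_padic_setD0 (D : set Qp) (h : Qp -> \bar R) : measurable D ->
  measurable_fun [set: Qp] h -> (forall x, (0 <= h x)%E) ->
  (\int[mu]_(x in D) h x = \int[mu]_(x in D `&` [set~ 0%R]) h x)%E.
Proof.
move=> mD mh h0.
rewrite -setDE; apply: ge0_negligible_integral => //.
- exact: measurable_padic_set0.
- exact: measurable_funTS.
- exact: haar_set0.
Qed.

Lemma integral_padic_spheres (D : set Qp) (h : Qp -> \bar R) : measurable D ->
  measurable_fun [set: Qp] h -> (forall x, (0 <= h x)%E) ->
  (\int[mu]_(x in D) h x =
   \esum_(k in [set: int]) \int[mu]_(x in D `&` padic_sphere k) h x)%E.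
Proof.
move=> mD mh h0; rewrite integral_padic_setD0// integral_mkcondl.
rewrite integral_padic_setC0//; last 2 first.
- by apply/(measurable_restrictT _ mD); exact: measurable_funTS.
- by move=> x; rewrite patchE; case: ifP.
by apply: eq_esum => k _; rewrite [RHS]integral_mkcondl.
Qed.

End HaarMeasure.

Set Implicit Arguments.
Unset Strict Implicit.

(** * Complex-valued integrals *)

Section ComplexModulus.
Context {R : realType}.
Implicit Types z w : R[i].

Lemma cabsE z : cabs z = Num.sqrt (complex.Re z ^+ 2 + complex.Im z ^+ 2).
Proof. by case: z. Qed.

Lemma cabs_ge0 z : 0 <= cabs z.
Proof. by rewrite cabsE sqrtr_ge0. Qed.

Lemma cabs_normr z : (cabs z)%:C = `|z|.
Proof. by case: z. Qed.

Lemma cabsM z w : cabs (z * w) = cabs z * cabs w.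
Proof. by apply: (@complexI R); rewrite rmorphM/= !cabs_normr normrM. Qed.

Lemma cabsD z w : cabs (z + w) <= cabs z + cabs w.
Proof. by rewrite -lecR rmorphD/= !cabs_normr ler_normD. Qed.

Lemma cabsN z : cabs (- z) = cabs z.
Proof. by apply: (@complexI R); rewrite !cabs_normr normrN. Qed.

Lemma cabsB z w : cabs (z - w) <= cabs z + cabs w.
Proof. by rewrite -(cabsN w) cabsD. Qed.

Lemma cabs0 : cabs (0 : R[i]) = 0.
Proof. by apply: (@complexI R); rewrite !cabs_normr normr0. Qed.

Lemma cabs_distC z w : cabs (z - w) = cabs (w - z).
Proof. by rewrite -cabsN opprB. Qed.

Lemma cabs_real (x : R) : cabs x%:C = `|x|.
Proof. by rewrite cabsE/= expr0n/= addr0 sqrtr_sqr. Qed.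

Lemma cabsV z : cabs z^-1 = (cabs z)^-1.
Proof. by apply: (@complexI R); rewrite fmorphV/= !cabs_normr normfV. Qed.

Lemma Re_le_cabs z : `|complex.Re z| <= cabs z.
Proof. by rewrite cabsE -sqrtr_sqr ler_sqrt ?addr_ge0 ?sqr_ge0// lerDl sqr_ge0. Qed.

Lemma Im_le_cabs z : `|complex.Im z| <= cabs z.
Proof. by rewrite cabsE -sqrtr_sqr ler_sqrt ?addr_ge0 ?sqr_ge0// lerDr sqr_ge0. Qed.

Lemma cabs_le_ReIm z : cabs z <= `|complex.Re z| + `|complex.Im z|.
Proof.
have s0 : 0 <= `|complex.Re z| + `|complex.Im z| by rewrite addr_ge0.
rewrite cabsE -[leRHS]ger0_norm// -sqrtr_sqr ler_sqrt ?sqr_ge0//.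
by rewrite sqrrD !real_normK ?num_real// lerD2r lerDl mulrn_wge0// mulr_ge0.
Qed.

End ComplexModulus.

Section ComplexMeasurable.
Context d (T : measurableType d) (R : realType).
Implicit Types (D : set T) (f g : T -> R[i]).

Lemma cmeasurable_cabs D f : cmeasurable D f ->
  measurable_fun D (fun x => cabs (f x)).
Proof.
move=> [mr mi]; under eq_fun do rewrite cabsE.
apply: measurableT_comp; last by apply: measurable_funD; exact: measurable_funX.
by apply: continuous_measurable_fun; exact: sqrt_continuous.
Qed.

Lemma cmeasurableM D f g : cmeasurable D f -> cmeasurable D g ->
  cmeasurable D (fun x => f x * g x).
Proof.
move=> [fr fi] [gr gi]; split.
  rewrite (_ : (fun x => _) = (fun x => complex.Re (f x) * complex.Re (g x) -
      complex.Im (f x) * complex.Im (g x))); last first.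
    by apply/funext => x; case: (f x) => ? ?; case: (g x).
  by apply: measurable_funB; exact: measurable_funM.
rewrite (_ : (fun x => _) = (fun x => complex.Re (f x) * complex.Im (g x) +
    complex.Im (f x) * complex.Re (g x))); last first.
  by apply/funext => x; case: (f x) => ? ?; case: (g x).
by apply: measurable_funD; exact: measurable_funM.
Qed.

Lemma cmeasurableB D f g : cmeasurable D f -> cmeasurable D g ->
  cmeasurable D (fun x => f x - g x).
Proof.
move=> [fr fi] [gr gi]; split.
  rewrite (_ : (fun x => _) = (fun x => complex.Re (f x) - complex.Re (g x))).
    exact: measurable_funB.
  by apply/funext => x; case: (f x) => ? ?; case: (g x).
rewrite (_ : (fun x => _) = (fun x => complex.Im (f x) - complex.Im (g x))).
  exact: measurable_funB.
by apply/funext => x; case: (f x) => ? ?; case: (g x).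
Qed.

Lemma cmeasurable_cst D (z : R[i]) : cmeasurable D (fun=> z).
Proof. by split; exact: measurable_cst. Qed.

Lemma cmeasurable_real D (h : T -> R) : measurable_fun D h ->
  cmeasurable D (fun x => (h x)%:C).
Proof. by move=> mh; split => //; exact: measurable_cst. Qed.

Lemma cmeasurable_sub D f : measurable D -> cmeasurable [set: T] f -> cmeasurable D f.
Proof. by move=> mD [fr fi]; split; exact: measurable_funTS. Qed.

End ComplexMeasurable.

Section ComplexIntegral.
Context d (T : measurableType d) (R : realType) (mu : {measure set T -> \bar R}).
Variables (D : set T) (mD : measurable D).
Implicit Types (f g : T -> R[i]) (z : R[i]).

Lemma cintegrable_cabs f : cmeasurable D f ->
  (\int[mu]_(x in D) (cabs (f x))%:E < +oo)%E -> cintegrable mu D f.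
Proof.
move=> mf fi; have mc := cmeasurable_cabs mf; case: mf => mr mi.
split; apply/integrableP; split; try exact/measurable_EFinP.
- apply: le_lt_trans fi; apply: ge0_le_integral => //.
  + by apply/measurable_EFinP; exact: measurableT_comp.
  + exact/measurable_EFinP.
  + by move=> x _; rewrite lee_fin; exact: Re_le_cabs.
- apply: le_lt_trans fi; apply: ge0_le_integral => //.
  + by apply/measurable_EFinP; exact: measurableT_comp.
  + exact/measurable_EFinP.
  + by move=> x _; rewrite lee_fin; exact: Im_le_cabs.
Qed.

(** Real and imaginary parts are estimated separately, each by M; this is the source of the factors
    2 in the later constants. *)
Lemma cabs_cintegral_le f (M : R) : cmeasurable D f ->
  (\int[mu]_(x in D) (cabs (f x))%:E <= M%:E)%E ->
  cabs (cintegral mu D f) <= 2 * M.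
Proof.
move=> mf fM; have [ir ii] := cintegrable_cabs mf (le_lt_trans fM (ltry _)).
have mc := cmeasurable_cabs mf; have [mr mi] := mf.
apply: (le_trans (cabs_le_ReIm _)); rewrite mulr_natl mulr2n; apply: lerD => /=.
  apply: le_trans (le_normr_Rintegral _ _) _ => //.
  rewrite -lee_fin; apply: le_trans fM.
  rewrite /Rintegral fineK; last exact: integrable_fin_num (integrable_abse ir).
  apply: ge0_le_integral => //.
  + by apply/measurable_EFinP; exact: measurableT_comp.
  + exact/measurable_EFinP.
  + by move=> x _; rewrite lee_fin; exact: Re_le_cabs.
apply: le_trans (le_normr_Rintegral _ _) _ => //.
rewrite -lee_fin; apply: le_trans fM.
rewrite /Rintegral fineK; last exact: integrable_fin_num (integrable_abse ii).
apply: ge0_le_integral => //.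
+ by apply/measurable_EFinP; exact: measurableT_comp.
+ exact/measurable_EFinP.
+ by move=> x _; rewrite lee_fin; exact: Im_le_cabs.
Qed.

Lemma cintegralB f g : cintegrable mu D f -> cintegrable mu D g ->
  cintegral mu D (fun x => f x - g x) = cintegral mu D f - cintegral mu D g.
Proof.
move=> [fr fi] [gr gi]; rewrite /cintegral.
have -> : (fun x => complex.Re (f x - g x)) =
    (fun x => complex.Re (f x) - complex.Re (g x)).
  by apply/funext => x; case: (f x) => ? ?; case: (g x).
have -> : (fun x => complex.Im (f x - g x)) =
    (fun x => complex.Im (f x) - complex.Im (g x)).
  by apply/funext => x; case: (f x) => ? ?; case: (g x).
by rewrite !RintegralB.
Qed.

Lemma cintegralZ z f : cintegrable mu D f ->
  cintegral mu D (fun x => z * f x) = z * cintegral mu D f.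
Proof.
case: z => a b [fr fi]; rewrite /cintegral.
have -> : (fun x => complex.Re (Complex a b * f x)) =
    (fun x => a * complex.Re (f x) - b * complex.Im (f x)).
  by apply/funext => x; case: (f x).
have -> : (fun x => complex.Im (Complex a b * f x)) =
    (fun x => a * complex.Im (f x) + b * complex.Re (f x)).
  by apply/funext => x; case: (f x).
have Zl c (h : T -> R) : mu.-integrable D (EFin \o h) ->
    mu.-integrable D (EFin \o (fun x => c * h x)).
  by move=> hi; exact: (integrableZl mD c hi).
rewrite RintegralB ?RintegralD//; try exact: Zl.
by rewrite !RintegralZl.
Qed.

End ComplexIntegral.

(** * Oscillation of functions of central mean oscillation *)

Lemma measurable_fun_powR d (T : measurableType d) (R : realType) (D : set T)
    (f : T -> R) (s : R) :
  measurable_fun D f -> measurable_fun D (fun x => f x `^ s).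
Proof.
move=> mf; have -> : (fun x => f x `^ s) = (@powR R ^~ s) \o f by [].
by apply: measurableT_comp.
Qed.

(** Since 1 + u >= 1, the exponent can be raised from t to s, and 1 + u is at most 2 or 2u. The
    constant does not depend on t, so a single CMO exponent s controls all moments of order t <=
    s. *)
Lemma powR_1D_le {R : realType} (s t u : R) : 0 <= u -> 0 <= t -> t <= s ->
  (1 + u) `^ t <= 2 `^ s * (1 + u `^ s).
Proof.
move=> u0 t0 ts; have s0 := le_trans t0 ts.
have u1 : 1 <= 1 + u by rewrite lerDl.
apply: (le_trans (ler_powR u1 ts)); have [u1'|/ltW u1'] := leP u 1.
  apply: (@le_trans _ _ (2 `^ s)); last by rewrite ler_peMr ?powR_ge0// lerDl powR_ge0.
  by apply: ge0_ler_powR => //; rewrite ?nnegrE ?addr_ge0//; lra.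
apply: (@le_trans _ _ ((2 * u) `^ s)).
  by apply: ge0_ler_powR => //; rewrite ?nnegrE ?mulr_ge0 ?addr_ge0//; lra.
by rewrite powRM// ler_wpM2l ?powR_ge0// lerDr.
Qed.

Section CMOBounds.
Context {R : realType} {p : nat} {p_pr : prime p}.
Local Notation Qp := (@Qp R p p_pr).
Local Notation P := (p%:R : R).
Variables (mu : {measure set Qp -> \bar R}) (mu_haar : normalized_haar mu).
Implicit Types (b : Qp -> R[i]) (k : int).

Lemma CMO_oscillation_le s b : 0 < s -> CMO mu s b ->
  exists2 N : R, 0 <= N & forall k,
    (\int[mu]_(x in padic_ball k) ((cabs (b x - ball_mean mu b k)) `^ s)%:E <=
     (N * P ^ k)%:E)%E.
Proof.
move=> s0 [_ bfin]; set M := CMO_norm mu s b in bfin.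
have s'0 : 0 <= s by exact: ltW.
have P0 k : 0 < P ^ k by rewrite exprz_gt0// (prime_gt0r p_pr).
have MN k : (((P ^ k)^-1%:E * \int[mu]_(x in padic_ball k)
    ((cabs (b x - ball_mean mu b k)) `^ s)%:E) `^ s^-1 <= M)%E.
  by apply: ereal_sup_ubound; exists k => //; rewrite (haar_padic_ball mu mu_haar).
have M0 : (0 <= M)%E by apply: le_trans (MN 0); exact: poweR_ge0.
have Mfin : M \is a fin_num by rewrite ge0_fin_numE.
exists (fine M `^ s); first exact: powR_ge0.
move=> k; set I := integral _ _ _.
have I0 : (0 <= I)%E by apply: integral_ge0 => x _; rewrite lee_fin powR_ge0.
have := le_poweR s'0 (poweR_ge0 _ _) (MN k).
have pos : (0 <= (P ^ k)^-1%:E * I)%E by rewrite mule_ge0// lee_fin invr_ge0 ltW.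
rewrite -poweRrM mulVf ?gt_eqF// poweRe1// -(fineK Mfin) poweR_EFin => H.
rewrite mulrC EFinM -lee_pdivrMl//.
Qed.

Lemma CMO_moment_le s b : 1 <= s -> CMO mu s b ->
  exists2 M : R, 0 <= M & forall k t, 0 <= t -> t <= s ->
    (\int[mu]_(x in padic_ball k) ((1 + cabs (b x - ball_mean mu b k)) `^ t)%:E <=
     (M * P ^ k)%:E)%E.
Proof.
move=> s1 bC; have s0 : 0 < s := lt_le_trans ltr01 s1.
have [N N0 HN] := CMO_oscillation_le s0 bC; have [[mb _] _] := bC.
exists (2 `^ s * (1 + N)); first by rewrite mulr_ge0 ?powR_ge0 ?addr_ge0.
move=> k t t0 ts; have mB := measurable_padic_ball k : measurable (padic_ball k : set Qp).
have mc : measurable_fun (padic_ball k) (fun x : Qp => cabs (b x - ball_mean mu b k)).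
  apply: cmeasurable_cabs; apply: cmeasurable_sub => //.
  by apply: cmeasurableB => //; exact: cmeasurable_cst.
have ms : measurable_fun (padic_ball k)
    (fun x : Qp => (cabs (b x - ball_mean mu b k) `^ s)).
  exact: measurable_fun_powR.
apply: (@le_trans _ _ (\int[mu]_(x in padic_ball k)
    ((2 `^ s)%:E * (1 + (cabs (b x - ball_mean mu b k) `^ s)%:E)))%E).
  apply: ge0_le_integral => //.
  - by move=> x _; rewrite lee_fin powR_ge0.
  - apply/measurable_EFinP; apply: measurable_fun_powR.
    exact: measurable_funD.
  - apply: measurable_funeM; apply: emeasurable_funD => //.
    exact/measurable_EFinP.
  - by move=> x _; rewrite -EFinD -EFinM lee_fin powR_1D_le// cabs_ge0.
rewrite ge0_integralZl//; last 2 first.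
- apply: emeasurable_funD => //; exact/measurable_EFinP.
- by move=> x _; rewrite adde_ge0// lee_fin powR_ge0.
rewrite -mulrA EFinM lee_wpmul2l ?lee_fin ?powR_ge0//.
rewrite ge0_integralD//; last 2 first.
- by move=> x _; rewrite lee_fin powR_ge0.
- exact/measurable_EFinP.
rewrite integral_cst// mul1e (haar_padic_ball mu mu_haar) mulrDl mul1r EFinD.
exact: leeD.
Qed.

(** The difference of the means is, up to sign, the average over B_k of b - c, with c the mean over
    B_(k+1). Its integral is bounded by the first moment on the larger ball, which costs the ratio p
    of the two volumes. *)
Lemma ball_mean_step_le s b : 1 <= s -> CMO mu s b ->
  exists2 L : R, 0 <= L & forall k,
    cabs (ball_mean mu b (k + 1) - ball_mean mu b k) <= L.
Proof.
move=> s1 bC; have [M M0 HM] := CMO_moment_le s1 bC; have [[mb _] _] := bC.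
have P0 := prime_gt0r p_pr : 0 < P.
exists (2 * M * P); first by rewrite !mulr_ge0// ltW.
move=> k; set c := ball_mean mu b (k + 1).
have mB : measurable (padic_ball k : set Qp) := measurable_padic_ball k.
have mbc D : measurable D -> cmeasurable D (fun x => b x - c).
  move=> mD; apply: cmeasurable_sub => //.
  by apply: cmeasurableB => //; exact: cmeasurable_cst.
have bcM : (\int[mu]_(x in padic_ball k) (cabs (b x - c))%:E <=
    (M * P ^ (k + 1))%:E)%E.
  have mB1 : measurable (padic_ball (k + 1) : set Qp) := measurable_padic_ball (k + 1).
  have m1 := cmeasurable_cabs (mbc _ mB1).
  apply: le_trans (HM (k + 1) 1 ler01 s1).
  apply: (@le_trans _ _ (\int[mu]_(x in padic_ball (k + 1)) (cabs (b x - c))%:E)%E).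
    apply: ge0_subset_integral => //.
    - exact/measurable_EFinP.
    - by move=> x _; rewrite lee_fin cabs_ge0.
    - move=> x; rewrite /padic_ball/= => /le_trans; apply.
      by rewrite ler_eXz2l ?(prime_gt1r p_pr)//; lia.
  apply: ge0_le_integral => //.
  - by move=> x _; rewrite lee_fin cabs_ge0.
  - exact/measurable_EFinP.
  - by apply/measurable_EFinP/measurable_fun_powR/measurable_funD.
  - by move=> x _; rewrite lee_fin powRr1 ?addr_ge0 ?cabs_ge0// lerDr.
have bci : cintegrable mu (padic_ball k) (fun x => b x - c).
  by apply: cintegrable_cabs => //; [exact: mbc|exact: (le_lt_trans bcM (ltry _))].
have ci z : cintegrable mu (padic_ball k) (fun=> z).
  apply: cintegrable_cabs => //.
  by rewrite integral_cst//= (haar_padic_ball mu mu_haar) -EFinM ltry.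
have cint z : cintegral mu (padic_ball k) (fun=> z) = (P ^ k)%:C * z.
  case: z => u v; rewrite /cintegral/= !Rintegral_cst// (haar_padic_ball mu mu_haar)/=.
  by apply/eqP; rewrite eq_complex/= !mul0r subr0 addr0 ![_ * P ^ k]mulrC !eqxx.
have Pk0 : (P ^ k)%:C != 0 :> R[i].
  by rewrite (_ : 0 = 0%:C)// (inj_eq (@complexI R)) gt_eqF// exprz_gt0.
have -> : c - ball_mean mu b k =
    - (((P ^ k)^-1)%:C * cintegral mu (padic_ball k) (fun x => b x - c)).
  have -> : ball_mean mu b k = ((P ^ k)^-1)%:C *
      (cintegral mu (padic_ball k) (fun x => b x - c) + (P ^ k)%:C * c).
    rewrite /ball_mean (haar_padic_ball mu mu_haar)/=; congr (_ * _).
    have -> : cintegral mu (padic_ball k) b =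
        cintegral mu (padic_ball k) (fun x => (b x - c) - (- c)).
      by congr cintegral; apply/funext => x; rewrite opprK subrK.
    by rewrite (cintegralB mB bci (ci _)) cint mulrN opprK.
  by rewrite fmorphV mulrDr mulKf// opprD addrCA subrr addr0.
rewrite cabsN cabsM cabs_real ger0_norm ?invr_ge0 ?exprz_ge0 ?(ltW P0)//.
rewrite mulrC ler_pdivrMr ?exprz_gt0//.
apply: le_trans (cabs_cintegral_le mB (mbc _ mB) bcM) _.
by rewrite expfzDr ?gt_eqF// expr1z; lra.
Qed.

(** Spheres inherit the moments of the balls containing them, and telescoping |k - j| consecutive
    means gives the Lipschitz bound. From here on [b] enters only through its measurability, [beta]
    and the single constant [K]. *)
Lemma CMO_approximation s b : 1 <= s -> CMO mu s b ->
  exists (K : R) (beta : int -> R[i]), [/\ 0 < K,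
    forall k t, 0 <= t -> t <= s ->
      (\int[mu]_(x in padic_sphere k) ((1 + cabs (b x - beta k)) `^ t)%:E <=
       (K * P ^ k)%:E)%E &
    forall j k, cabs (beta j - beta k) <= K * `|k - j|%N%:R].
Proof.
move=> s1 bC; have [M M0 HM] := CMO_moment_le s1 bC.
have [L L0 HL] := ball_mean_step_le s1 bC; have [[mb _] _] := bC.
exists (1 + M + L), (ball_mean mu b).
have stepn j (n : nat) : cabs (ball_mean mu b (j + n%:Z) - ball_mean mu b j) <= L * n%:R.
  elim: n => [|n IH]; first by rewrite addr0 subrr cabs0 mulr0.
  rewrite (_ : j + n.+1%:Z = (j + n%:Z) + 1); last by lia.
  rewrite -[X in cabs (X - _)](subrK (ball_mean mu b (j + n%:Z))) -addrA.
  by rewrite (le_trans (cabsD _ _))// -natr1 mulrDr mulr1 [leRHS]addrC lerD.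
have lip j k : cabs (ball_mean mu b j - ball_mean mu b k) <= L * `|k - j|%N%:R.
  have [jk|/ltW kj] := leP j k.
    by rewrite cabs_distC -{1}(_ : j + `|k - j|%N%:Z = k)//; lia.
  by rewrite -{1}(_ : k + `|k - j|%N%:Z = j)//; lia.
split=> [|k t t0 ts|j k].
- by rewrite -addrA ltr_pwDl// addr_ge0.
- apply: (@le_trans _ _ (M * P ^ k)%:E); last first.
    rewrite lee_fin ler_wpM2r ?exprz_ge0 ?ler0n//.
    by rewrite addrAC lerDr addr_ge0.
  apply: le_trans (HM k t t0 ts); apply: ge0_subset_integral => //.
  + exact: measurable_padic_sphere.
  + exact: measurable_padic_ball.
  + apply/measurable_EFinP/measurable_fun_powR/measurable_funD => //.
    apply: cmeasurable_cabs; apply: cmeasurable_sub; first exact: measurable_padic_ball.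
    by apply: cmeasurableB => //; exact: cmeasurable_cst.
  + by move=> x _; rewrite lee_fin powR_ge0.
  + by move=> x [].
- by rewrite (le_trans (lip j k))// ler_wpM2r// lerDr addr_ge0.
Qed.

End CMOBounds.

(** * The commutator *)

(** This is the inequality on the whole space applied to u and v cut off by the indicator of [D]. *)
Lemma hoelder_on d (T : measurableType d) (R : realType)
    (mu : {measure set T -> \bar R}) (D : set T) (u v : T -> R) (s t : R) :
  measurable D -> measurable_fun [set: T] u -> measurable_fun [set: T] v ->
  (forall x, 0 <= u x) -> (forall x, 0 <= v x) ->
  0 < s -> 0 < t -> s^-1 + t^-1 = 1 ->
  (\int[mu]_(x in D) (u x * v x)%:E <=
   (\int[mu]_(x in D) (u x `^ s)%:E) `^ s^-1 *
   (\int[mu]_(x in D) (v x `^ t)%:E) `^ t^-1)%E.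
Proof.
move=> mD mu_ mv u0 v0 s0 t0 st.
pose res (w : T -> R) x := w x * \1_D x.
have mres w : measurable_fun [set: T] w -> measurable_fun [set: T] (res w).
  by move=> mw; apply: measurable_funM => //; exact: measurable_indic.
have Lr (w : T -> R) a : 0 < a -> (forall x, 0 <= w x) ->
    Lnorm mu a%:E (EFin \o res w) = ((\int[mu]_(x in D) (w x `^ a)%:E) `^ a^-1)%E.
  move=> a0 w0; rewrite unlock; congr (_ `^ _)%E.
  rewrite [RHS]integral_mkcond; apply: eq_integral => x _ /=.
  rewrite /res patchE indicE; case: (x \in D); first by rewrite mulr1 ger0_norm.
  by rewrite mulr0 normr0 powR0// gt_eqF.
have := hoelder mu (mres _ mu_) (mres _ mv) s0 t0 st.
rewrite !Lr//; apply: le_trans; rewrite unlock invr1 poweRe1; last first.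
  by apply: integral_ge0 => x _; exact: poweR_ge0.
rewrite integral_mkcond le_eqVlt; apply/orP; left; apply/eqP.
apply: eq_integral => x _ /=; rewrite /res patchE indicE powRr1//.
by case: (x \in D) => /=; rewrite ?mulr1 ?mulr0 ?normr0// ger0_norm// mulr_ge0.
Qed.

Section MainEstimate.
Context {R : realType} {p : nat} {p_pr : prime p}.
Local Notation Qp := (@Qp R p p_pr).
Local Notation P := (p%:R : R).
Variables (mu : {measure set Qp -> \bar R}) (mu_haar : normalized_haar mu).
Variables (r r' : R) (r1 : 1 < r) (rr' : r^-1 + r'^-1 = 1).
Variables (b : Qp -> R[i]) (mb : cmeasurable [set: Qp] b).
Variables (K : R) (beta : int -> R[i]) (K0 : 0 < K).
Hypothesis beta_moment : forall k t, t = r \/ t = r' ->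
  (\int[mu]_(x in padic_sphere k) ((1 + cabs (b x - beta k)) `^ t)%:E <=
   (K * P ^ k)%:E)%E.
Hypothesis beta_lip : forall j k, cabs (beta j - beta k) <= K * `|k - j|%N%:R.
Implicit Types (f : Qp -> R[i]) (k j : int) (W : int -> R).

Let r0 : 0 < r. Proof. exact: lt_trans ltr01 r1. Qed.
Let r'0 : 0 < r'.
Proof.
rewrite -invr_gt0 (_ : r'^-1 = 1 - r^-1); last by rewrite -rr' addrAC subrr add0r.
by rewrite subr_gt0 invf_lt1.
Qed.
Let P1 : 1 < P. Proof. exact: prime_gt1r. Qed.
Let P0 : 0 < P. Proof. exact: prime_gt0r. Qed.
Let Pz k : 0 < P ^ k. Proof. exact: exprz_gt0. Qed.

Definition sphere_norm f k := cLnorm mu r (fun x => f x * \1_(padic_sphere k) x).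

(** The value on S_k of the operator T applied to (1 + |b - beta k|) |f|. The summand 1 makes it
    dominate at once the integrals for f and for (b - beta k) f. *)
Definition oscillation_integral f k :=
  (\int[mu]_(y in [set~ 0%R])
     ((1 + cabs (b y - beta k)) * cabs (f y) / Num.max (P ^ k) (padic_abs y))%:E)%E.

Local Notation F := sphere_norm.
Local Notation I := oscillation_integral.

Lemma sphere_norm_ge0 f k : (0 <= F f k)%E.
Proof. exact: Lnorm_ge0. Qed.

Lemma sphere_normE f k :
  F f k = ((\int[mu]_(x in padic_sphere k) (cabs (f x) `^ r)%:E) `^ r^-1)%E.
Proof.
rewrite /sphere_norm /cLnorm unlock; congr (_ `^ _)%E.
rewrite [RHS]integral_mkcond; apply: eq_integral => x _ /=.
rewrite patchE indicE cabsM; case: (x \in _).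
  by rewrite (cabs_real 1) normr1 mulr1 ger0_norm// cabs_ge0.
by rewrite cabs0 mulr0 normr0 powR0// gt_eqF.
Qed.

Lemma sphere_norm_poweR f k :
  (F f k `^ r = \int[mu]_(x in padic_sphere k) (cabs (f x) `^ r)%:E)%E.
Proof.
rewrite sphere_normE -poweRrM mulVf ?gt_eqF// poweRe1//.
by apply: integral_ge0 => x _; rewrite lee_fin powR_ge0.
Qed.

Lemma oscillation_integral_ge0 f k : (0 <= I f k)%E.
Proof.
apply: integral_ge0 => y _; rewrite lee_fin divr_ge0// ?mulr_ge0 ?cabs_ge0//.
  by rewrite addr_ge0// cabs_ge0.
by rewrite le_max ltW.
Qed.

Let mbk k : measurable_fun [set: Qp] (fun y => 1 + cabs (b y - beta k)).
Proof.
apply: measurable_funD => //; apply: cmeasurable_cabs.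
by apply: cmeasurableB => //; exact: cmeasurable_cst.
Qed.

Let osc_ge0 k y : 0 <= 1 + cabs (b y - beta k).
Proof. by rewrite addr_ge0// cabs_ge0. Qed.

Lemma sphere_hoelder f j : cmeasurable [set: Qp] f ->
  (\int[mu]_(y in padic_sphere j) ((1 + cabs (b y - beta j)) * cabs (f y))%:E <=
   (K `^ r'^-1 * P `^ (j%:~R * r'^-1))%:E * F f j)%E.
Proof.
move=> mf; rewrite sphere_normE.
have st : r'^-1 + r^-1 = 1 by rewrite addrC.
have := hoelder_on mu (measurable_padic_sphere j) (mbk j) (cmeasurable_cabs mf)
  (osc_ge0 j) (fun x => cabs_ge0 (f x)) r'0 r0 st.
move=> /le_trans; apply; rewrite lee_wpmul2r ?poweR_ge0//.
have -> : (K `^ r'^-1 * P `^ (j%:~R * r'^-1))%:E = ((K * P ^ j)%:E `^ r'^-1)%E.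
  by rewrite poweR_EFin powRM ?ltW// -powR_intmul ?ltW// -powRrM.
apply: le_poweR; first by rewrite invr_ge0 ltW.
  by apply: integral_ge0 => x _; rewrite lee_fin powR_ge0.
by apply: beta_moment; right.
Qed.

(** The three factors come from replacing [beta k] by [beta j], from the kernel 1 / max(|x|, |y|) on
    S_k x S_j, and from Hoelder's inequality on S_j. *)
Definition hlp_kernel k j : R :=
  (2 + K * `|k - j|%N%:R) * (P ^ (Num.max k j))^-1 * P `^ (j%:~R * r'^-1).

Lemma hlp_kernel_gt0 k j : 0 < hlp_kernel k j.
Proof.
rewrite !mulr_gt0 ?invr_gt0 ?powR_gt0//.
by rewrite ltr_pwDl// mulr_ge0// ltW.
Qed.

Lemma measurable_oscillation f k : cmeasurable [set: Qp] f ->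
  measurable_fun [set: Qp]
    (fun y => (1 + cabs (b y - beta k)) * cabs (f y) / Num.max (P ^ k) (padic_abs y)).
Proof.
move=> mf; apply: measurable_funM.
  by apply: measurable_funM => //; exact: cmeasurable_cabs.
exact: (measurable_fun_padic_abs _ _ (fun t => (Num.max (P ^ k) t)^-1)).
Qed.

(** On S_j the moment bound is available for the centre [beta j] only. The Lipschitz bound gives 1 +
    |b - beta k| <= (2 + K |k - j|) (1 + |b - beta j|), after which [sphere_hoelder] applies on each
    sphere. *)
Lemma oscillation_integral_le f k : cmeasurable [set: Qp] f ->
  (I f k <= \esum_(j in [set: int]) ((K `^ r'^-1 * hlp_kernel k j)%:E * F f j))%E.
Proof.
move=> mf; rewrite /oscillation_integral integral_padic_setC0//; last 2 first.
- by apply/measurable_EFinP; exact: measurable_oscillation.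
- move=> y; rewrite lee_fin divr_ge0// ?mulr_ge0 ?cabs_ge0//.
  by rewrite le_max ltW.
apply: le_esum => j _; have mS := measurable_padic_sphere j : measurable (padic_sphere j : set Qp).
pose c := (2 + K * `|k - j|%N%:R) * (P ^ (Num.max k j))^-1.
have c0 : 0 <= c by rewrite mulr_ge0 ?invr_ge0 ?(ltW (Pz _))// addr_ge0// mulr_ge0// ltW.
apply: (@le_trans _ _ (\int[mu]_(y in padic_sphere j)
    (c%:E * ((1 + cabs (b y - beta j)) * cabs (f y))%:E))%E).
  apply: ge0_le_integral => //.
  - move=> y _; rewrite lee_fin divr_ge0// ?mulr_ge0 ?cabs_ge0//.
    by rewrite le_max ltW.
  - by apply: measurable_funTS; apply/measurable_EFinP; exact: measurable_oscillation.
  - apply: measurable_funeM; apply: measurable_funTS; apply/measurable_EFinP.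
    by apply: measurable_funM => //; exact: cmeasurable_cabs.
  - move=> y /padic_sphereP yj; rewrite -EFinM lee_fin yj.
    have -> : Num.max (P ^ k) (P ^ j) = P ^ (Num.max k j).
      by rewrite /Order.max ltr_eXz2l//; case: ifP.
    rewrite /c [leRHS]mulrAC ler_wpM2r ?invr_ge0 ?(ltW (Pz _))// mulrA ler_wpM2r ?cabs_ge0//.
    have : cabs (b y - beta k) <= cabs (b y - beta j) + K * `|k - j|%N%:R.
      have -> : b y - beta k = (b y - beta j) + (beta j - beta k) by rewrite addrA subrK.
      by rewrite (le_trans (cabsD _ _))// lerD2l.
    have := cabs_ge0 (b y - beta j); have : 0 <= K * `|k - j|%N%:R by rewrite mulr_ge0// ltW.
    by nra.
rewrite ge0_integralZl_EFin//; last 2 first.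
- by move=> y _; rewrite lee_fin mulr_ge0 ?cabs_ge0.
- apply: measurable_funTS; apply/measurable_EFinP.
  by apply: measurable_funM => //; exact: cmeasurable_cabs.
apply: le_trans (lee_wpmul2l _ (sphere_hoelder j mf)) _; first by rewrite lee_fin.
rewrite muleA -EFinM le_eqVlt; apply/orP; left; apply/eqP; congr (_%:E * _)%E.
by rewrite /hlp_kernel /c; ring.
Qed.

(** The admissible weights: per step, growth below p^(1/r') to the right and below p^(1/r) to the
    left, with a uniform margin [eps], as [weighted_kernel_bound] requires. *)
Definition moderate_weight W := exists eps : R, [/\ 0 < eps, forall k, 0 < W k,
  forall j k, j <= k -> W k <= W j * P `^ ((k - j)%:~R * (r'^-1 - eps)) &
  forall j k, k <= j -> W k <= W j * P `^ ((j - k)%:~R * (r^-1 - eps))].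

(** The factor p^(k/r) is, up to a constant, the L^r norm of the function 1 on S_k. No finiteness is
    assumed: both sides may be infinite. *)
Lemma weighted_oscillation_le W q : moderate_weight W -> 0 < q ->
  exists2 C : R, 0 < C & forall f, cmeasurable [set: Qp] f ->
    (\esum_(k in [set: int]) (((W k * P `^ (k%:~R * r^-1))%:E * I f k) `^ q) <=
     C%:E * \esum_(j in [set: int]) (((W j)%:E * F f j) `^ q))%E.
Proof.
move=> [eps [eps0 W0 Wl Wr]] q0.
have [d d01 [C1 C10 HC1]] :=
  weighted_kernel_bound P K r^-1 r'^-1 eps W P1 (ltW K0) eps0 rr' W0 Wl Wr.
have [C2 C20 HC2] := geometric_convolution_bound d q d01 q0.
pose c := C1 * K `^ r'^-1; have c0 : 0 < c by rewrite mulr_gt0// powR_gt0.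
have cW0 j : 0 <= c * W j by rewrite mulr_ge0 ?ltW.
have Wr0 k : 0 < W k * P `^ (k%:~R * r^-1) by rewrite mulr_gt0 ?powR_gt0.
exists (C2 * c `^ q); first by rewrite mulr_gt0// powR_gt0.
move=> f mf; apply: le_trans (HC2 (fun j => (c * W j)%:E * F f j)%E _ _ _ _) _.
- by move=> j; rewrite mule_ge0 ?sphere_norm_ge0// lee_fin.
- by move=> k; rewrite mule_ge0 ?oscillation_integral_ge0// lee_fin ltW.
- move=> k; apply: le_trans (lee_wpmul2l _ (oscillation_integral_le k mf)) _.
    by rewrite lee_fin ltW.
  have Kk j : 0 <= K `^ r'^-1 * hlp_kernel k j.
    by rewrite mulr_ge0 ?powR_ge0// ltW// hlp_kernel_gt0.
  rewrite -esumZl//; last by move=> j; rewrite mule_ge0 ?sphere_norm_ge0// lee_fin.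
  apply: le_esum => j _; rewrite !muleA -!EFinM lee_wpmul2r ?sphere_norm_ge0// lee_fin.
  have := ler_wpM2l (powR_ge0 K r'^-1) (HC1 k j); rewrite /hlp_kernel /c.
  have -> : K `^ r'^-1 * (C1 * (d ^+ (2 * `|k - j|) * W j)) =
    d ^+ (2 * `|k - j|) * (C1 * K `^ r'^-1 * W j) by ring.
  by apply: le_trans; rewrite le_eqVlt; apply/orP; left; apply/eqP; ring.
rewrite EFinM -muleA lee_wpmul2l ?lee_fin ?(ltW C20)//.
rewrite -esumZl ?powR_gt0//; last by move=> j; exact: poweR_ge0.
apply: le_esum => j _; rewrite EFinM -muleA [leLHS]poweRM ?poweR_EFin ?lee_fin ?(ltW c0)//.
by rewrite mule_ge0 ?sphere_norm_ge0// lee_fin ltW.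
Qed.

Lemma cabs_HLP_integrand f x y :
  cabs (HLP_integrand f x y) = cabs (f y) / Num.max (padic_abs x) (padic_abs y).
Proof.
rewrite /HLP_integrand cabsM cabsV cabs_real ger0_norm//.
by rewrite le_max padic_abs_ge0.
Qed.

Lemma cmeasurable_HLP_integrand f x : cmeasurable [set: Qp] f ->
  cmeasurable [set: Qp] (HLP_integrand f x).
Proof.
move=> mf; rewrite /HLP_integrand; apply: cmeasurableM => //.
under eq_fun do rewrite -fmorphV; apply: cmeasurable_real.
exact: (measurable_fun_padic_abs _ _ (fun t => (Num.max (padic_abs x) t)^-1)).
Qed.

(** [c] is 1 for f and (b - beta k) f, whose integrals are estimated; it involves |beta k| for b f
    and beta k f, from which only integrability is drawn. *)
Lemma integral_HLP_integrand_le f g k x (c : R) : padic_abs x = P ^ k -> 0 <= c ->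
  cmeasurable [set: Qp] f -> cmeasurable [set: Qp] g ->
  (forall y, cabs (g y) <= c * ((1 + cabs (b y - beta k)) * cabs (f y))) ->
  (\int[mu]_(y in [set~ 0%R]) (cabs (HLP_integrand g x y))%:E <= c%:E * I f k)%E.
Proof.
move=> xk c0 mf mg gf; rewrite /oscillation_integral.
have mo := measurable_oscillation k mf.
have mC0 := measurable_padic_setC0 : measurable ([set~ 0%R] : set Qp).
rewrite -ge0_integralZl_EFin//; last 2 first.
- move=> y _; rewrite lee_fin divr_ge0 ?mulr_ge0 ?cabs_ge0//.
  by rewrite le_max ltW.
- by apply: measurable_funTS; apply/measurable_EFinP.
apply: ge0_le_integral => //.
- by move=> y _; rewrite lee_fin cabs_ge0.
- apply: measurable_funTS; apply/measurable_EFinP; apply: cmeasurable_cabs.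
  exact: cmeasurable_HLP_integrand.
- by apply: measurable_funeM; apply: measurable_funTS; apply/measurable_EFinP.
- move=> y _; rewrite -EFinM lee_fin cabs_HLP_integrand xk mulrA ler_wpM2r//.
  by rewrite invr_ge0 le_max ltW.
Qed.

Lemma cintegrable_HLP_integrand f g k x (c : R) : padic_abs x = P ^ k -> 0 <= c ->
  cmeasurable [set: Qp] f -> cmeasurable [set: Qp] g ->
  (forall y, cabs (g y) <= c * ((1 + cabs (b y - beta k)) * cabs (f y))) ->
  (I f k < +oo)%E -> cintegrable mu [set~ 0%R] (HLP_integrand g x).
Proof.
move=> xk c0 mf mg gf If.
have mC0 := measurable_padic_setC0 : measurable ([set~ 0%R] : set Qp).
apply: cintegrable_cabs => //.
  by apply: cmeasurable_sub => //; exact: cmeasurable_HLP_integrand.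
apply: le_lt_trans (integral_HLP_integrand_le xk c0 mf mg gf) _.
by rewrite lte_mul_pinfty// lee_fin.
Qed.

Lemma HLP_le f g k x : padic_abs x = P ^ k ->
  cmeasurable [set: Qp] f -> cmeasurable [set: Qp] g ->
  (forall y, cabs (g y) <= (1 + cabs (b y - beta k)) * cabs (f y)) ->
  (I f k < +oo)%E -> cabs (HLP mu g x) <= 2 * fine (I f k).
Proof.
move=> xk mf mg gf If.
have mC0 := measurable_padic_setC0 : measurable ([set~ 0%R] : set Qp).
apply: cabs_cintegral_le => //.
  by apply: cmeasurable_sub => //; exact: cmeasurable_HLP_integrand.
rewrite fineK ?ge0_fin_numE ?oscillation_integral_ge0//.
rewrite -[leRHS]mul1e; apply: integral_HLP_integrand_le => //.
by move=> y; rewrite mul1r.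
Qed.

Let cabs_f_le f k y : cabs (f y) <= (1 + cabs (b y - beta k)) * cabs (f y).
Proof. by rewrite ler_peMl ?cabs_ge0// lerDl cabs_ge0. Qed.

Let cabs_bf_le f k y :
  cabs (b y * f y) <= (1 + cabs (beta k)) * ((1 + cabs (b y - beta k)) * cabs (f y)).
Proof.
rewrite cabsM mulrA ler_wpM2r ?cabs_ge0//.
have : cabs (b y) <= cabs (b y - beta k) + cabs (beta k).
  by rewrite -{1}[b y](subrK (beta k)) cabsD.
have := cabs_ge0 (b y - beta k); have := cabs_ge0 (beta k).
by nra.
Qed.

(** The bound on b f has the constant 1 + |beta k|, which is not uniform in k; it serves convergence
    only and never reaches the norm estimate. *)
Lemma HLP_integrands_cintegrable f k x : padic_abs x = P ^ k ->
  cmeasurable [set: Qp] f -> (I f k < +oo)%E ->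
  cintegrable mu [set~ 0%R] (HLP_integrand f x) /\
  cintegrable mu [set~ 0%R] (HLP_integrand (fun y => b y * f y) x).
Proof.
move=> xk mf If; split.
  by apply: (cintegrable_HLP_integrand xk ler01 mf) => // y; rewrite mul1r.
apply: (cintegrable_HLP_integrand xk _ mf _ (cabs_bf_le f k)) => //.
  by rewrite addr_ge0// cabs_ge0.
exact: cmeasurableM.
Qed.

(** With [b] replaced by b - beta k, both T f and T((b - beta k) f) are at most twice the same
    oscillation integral. Finiteness of that integral gives the integrability behind the
    replacement. *)
Lemma HLP_commutator_le f k x : padic_abs x = P ^ k ->
  cmeasurable [set: Qp] f -> (I f k < +oo)%E ->
  cabs (HLP_commutator mu b f x) <= 2 * (1 + cabs (b x - beta k)) * fine (I f k).
Proof.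
move=> xk mf If; have [fi bfi] := HLP_integrands_cintegrable xk mf If.
have mC0 := measurable_padic_setC0 : measurable ([set~ 0%R] : set Qp).
have mbf : cmeasurable [set: Qp] (fun y => (b y - beta k) * f y).
  by apply: cmeasurableM => //; apply: cmeasurableB => //; exact: cmeasurable_cst.
have zfi : cintegrable mu [set~ 0%R] (fun y => beta k * HLP_integrand f x y).
  have -> : (fun y => beta k * HLP_integrand f x y) =
      HLP_integrand (fun y => beta k * f y) x.
    by apply/funext => y; rewrite /HLP_integrand mulrA.
  apply: (cintegrable_HLP_integrand xk (cabs_ge0 (beta k)) mf _ _ If).
    by apply: cmeasurableM => //; exact: cmeasurable_cst.
  by move=> y; rewrite cabsM ler_wpM2l ?cabs_ge0// cabs_f_le.
have -> : HLP_commutator mu b f x = (b x - beta k) * HLP mu f x -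
    HLP mu (fun y => (b y - beta k) * f y) x.
  have -> : HLP mu (fun y => (b y - beta k) * f y) x =
      HLP mu (fun y => b y * f y) x - beta k * HLP mu f x.
    rewrite /HLP -cintegralZ// -cintegralB//; congr cintegral; apply/funext => y.
    by rewrite /HLP_integrand mulrBl mulrBl mulrA.
  by rewrite /HLP_commutator; ring.
apply: (le_trans (cabsB _ _)).
have -> : 2 * (1 + cabs (b x - beta k)) * fine (I f k) =
    cabs (b x - beta k) * (2 * fine (I f k)) + 2 * fine (I f k) by ring.
apply: lerD.
  by rewrite cabsM ler_wpM2l ?cabs_ge0// (HLP_le xk mf)// => y; exact: cabs_f_le.
apply: (HLP_le xk mf) => // y.
by rewrite cabsM ler_wpM2r ?cabs_ge0// lerDr.
Qed.

(** T f(x) depends on x only through |x|, so it is constant on spheres. *)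
Lemma cmeasurable_HLP f : cmeasurable [set: Qp] (HLP mu f).
Proof.
pose h (t : R) := cintegral mu [set~ 0%R] (fun y => f y / (Num.max t (padic_abs y))%:C).
split.
  exact: (measurable_fun_padic_abs _ _ (fun t => complex.Re (h t))).
exact: (measurable_fun_padic_abs _ _ (fun t => complex.Im (h t))).
Qed.

Lemma cmeasurable_HLP_commutator f : cmeasurable [set: Qp] (HLP_commutator mu b f).
Proof.
apply: cmeasurableB; last exact: cmeasurable_HLP.
by apply: cmeasurableM => //; exact: cmeasurable_HLP.
Qed.

(** The exceptional set is the null set {0}: any other x lies on some S_k, where the k-th
    oscillation integral dominates both integrands up to a factor. *)
Lemma HLP_commutator_is_defined f : cmeasurable [set: Qp] f ->
  (forall k, (I f k < +oo)%E) -> HLP_commutator_defined mu b f.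
Proof.
move=> mf If.
have sub (Q : Qp -> Prop) : (forall x, x != 0 -> Q x) -> {ae mu, forall x, Q x}.
  move=> H; exists [set 0]; split.
  - exact: measurable_padic_set0.
  - exact: haar_set0.
  - move=> x /= nQ; apply: contrapT => /eqP x0; exact/nQ/H.
split; apply: sub => x x0; have [k xk] := padic_abs_expz x x0.
  by have [] := HLP_integrands_cintegrable xk mf (If k).
by have [] := HLP_integrands_cintegrable xk mf (If k).
Qed.

(** In the pointwise bound the oscillation integral is constant on S_k, so only the moment of order
    r of 1 + |b - beta k| is integrated; its r-th root gives K^(1/r) p^(k/r). *)
Lemma sphere_norm_HLP_commutator_le f k : cmeasurable [set: Qp] f ->
  (I f k < +oo)%E ->
  (F (HLP_commutator mu b f) k <=
   (2 * K `^ r^-1)%:E * ((P `^ (k%:~R * r^-1))%:E * I f k))%E.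
Proof.
move=> mf If; have I0 := oscillation_integral_ge0 f k.
have Ifin : I f k \is a fin_num by rewrite ge0_fin_numE.
have i0 : 0 <= 2 * fine (I f k) by rewrite mulr_ge0// fine_ge0.
have mS := measurable_padic_sphere k : measurable (padic_sphere k : set Qp).
rewrite sphere_normE.
have H : (\int[mu]_(x in padic_sphere k) (cabs (HLP_commutator mu b f x) `^ r)%:E <=
    ((2 * fine (I f k)) `^ r * (K * P ^ k))%:E)%E.
  apply: (@le_trans _ _ (\int[mu]_(x in padic_sphere k)
      (((2 * fine (I f k)) `^ r)%:E * ((1 + cabs (b x - beta k)) `^ r)%:E))%E).
    apply: ge0_le_integral => //.
    - by move=> x _; rewrite lee_fin powR_ge0.
    - apply: measurable_funTS; apply/measurable_EFinP; apply: measurable_fun_powR.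
      by apply: cmeasurable_cabs; exact: cmeasurable_HLP_commutator.
    - apply: measurable_funeM; apply: measurable_funTS; apply/measurable_EFinP.
      exact: measurable_fun_powR.
    - move=> x /padic_sphereP xk; rewrite -EFinM lee_fin -powRM//.
      apply: ge0_ler_powR; rewrite ?nnegrE ?cabs_ge0 ?mulr_ge0 ?(ltW r0)//.
        by rewrite fine_ge0.
      by rewrite (le_trans (HLP_commutator_le xk mf If))// mulrAC.
  rewrite ge0_integralZl_EFin ?powR_ge0//; last 2 first.
  - by move=> x _; rewrite lee_fin powR_ge0.
  - apply: measurable_funTS; apply/measurable_EFinP; exact: measurable_fun_powR.
  by rewrite EFinM lee_wpmul2l ?lee_fin ?powR_ge0// beta_moment//; left.
have r'p : 0 <= r^-1 by rewrite invr_ge0 ltW.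
have pos : (0 <= \int[mu]_(x in padic_sphere k)
    (cabs (HLP_commutator mu b f x) `^ r)%:E)%E.
  by apply: integral_ge0 => x _; rewrite lee_fin powR_ge0.
apply: le_trans (le_poweR r'p pos H) _.
rewrite poweR_EFin -[I f k]fineK// -!EFinM lee_fin.
rewrite powRM ?powR_ge0 ?mulr_ge0 ?(ltW K0) ?(ltW (Pz k))//.
rewrite -powRrM divff ?gt_eqF// powRr1// powRM ?(ltW K0) ?(ltW (Pz k))//.
rewrite -powR_intmul ?(ltW P0)// -powRrM/=.
by rewrite le_eqVlt; apply/orP; left; apply/eqP; ring.
Qed.

Lemma weighted_commutator_le W q : moderate_weight W -> 0 < q ->
  exists2 C : R, 0 < C & forall f, cmeasurable [set: Qp] f ->
    (forall k, (I f k < +oo)%E) ->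
    (\esum_(k in [set: int]) (((W k)%:E * F (HLP_commutator mu b f) k) `^ q) <=
     C%:E * \esum_(j in [set: int]) (((W j)%:E * F f j) `^ q))%E.
Proof.
move=> mW q0; have [C C0 HC] := weighted_oscillation_le mW q0.
have [_ [_ W0 _ _]] := mW; pose c := 2 * K `^ r^-1.
have c0 : 0 < c by rewrite mulr_gt0// powR_gt0.
exists (c `^ q * C); first by rewrite mulr_gt0// powR_gt0.
move=> f mf If.
have v0 k : (0 <= (W k * P `^ (k%:~R * r^-1))%:E * I f k)%E.
  rewrite mule_ge0 ?oscillation_integral_ge0// lee_fin mulr_ge0 ?powR_ge0//.
  exact: ltW.
rewrite EFinM -muleA; apply: le_trans (lee_wpmul2l _ (HC f mf)); last first.
  by rewrite lee_fin powR_ge0.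
rewrite -esumZl ?powR_gt0//; last by move=> k; exact: poweR_ge0.
apply: le_esum => k _; rewrite -poweR_EFin -poweRM ?lee_fin ?(ltW c0)//.
apply: le_poweR; first exact: ltW.
  by rewrite mule_ge0 ?sphere_norm_ge0// lee_fin ltW.
have Wk : (0 <= (W k)%:E)%E by rewrite lee_fin ltW.
apply: le_trans (lee_wpmul2l Wk (sphere_norm_HLP_commutator_le mf (If k))) _.
rewrite !muleA -!EFinM le_eqVlt; apply/orP; left; apply/eqP; congr (_%:E * _)%E.
by rewrite /c; ring.
Qed.

(** The k-th term of a finite sum of nonnegative terms is finite, and its factor W k p^(k/r) is
    positive. This turns a finite weighted norm of f into convergence of the integrals defining the
    commutator. *)
Lemma oscillation_integral_lty W q f : moderate_weight W -> 0 < q ->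
  cmeasurable [set: Qp] f ->
  (\esum_(j in [set: int]) (((W j)%:E * F f j) `^ q) < +oo)%E ->
  forall k, (I f k < +oo)%E.
Proof.
move=> mW q0 mf fin k; have [C C0 HC] := weighted_oscillation_le mW q0.
have [_ [_ W0 _ _]] := mW.
have : (((W k * P `^ (k%:~R * r^-1))%:E * I f k) `^ q < +oo)%E.
  apply: le_lt_trans (le_trans _ (HC f mf)) _; last first.
    by rewrite lte_mul_pinfty// lee_fin ltW.
  apply: (esum_term_le (fun k => ((W k * P `^ (k%:~R * r^-1))%:E * I f k) `^ q)%E).
  by move=> i; exact: poweR_ge0.
move=> /lty_poweRy; rewrite gt_eqF// => /(_ isT).
rewrite !ltey; apply: contra => /eqP ->.
by rewrite gt0_muley// lte_fin mulr_gt0// powR_gt0.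
Qed.

(** * The two families of weights *)

Lemma moderate_power_weight alpha : - r^-1 < alpha -> alpha < r'^-1 ->
  moderate_weight (fun k => P `^ (k%:~R * alpha)).
Proof.
(* The margin is the distance from alpha to the nearer endpoint of (-1/r, 1/r'). *)
move=> a1 a2; exists (Num.min (r'^-1 - alpha) (r^-1 + alpha)).
set e := Num.min _ _.
have e1 : e <= r'^-1 - alpha by rewrite ge_min lexx.
have e2 : e <= r^-1 + alpha by rewrite ge_min lexx orbT.
split=> [|k|j k jk|j k kj].
- by rewrite lt_min; apply/andP; split; lra.
- exact: powR_gt0.
- rewrite -powRD ?(gt_eqF P0) ?implybT//; apply: ler_powR; first exact: ltW.
  have : (0 : R) <= (k - j)%:~R by rewrite ler0z subr_ge0.
  by rewrite intrB; nra.
- rewrite -powRD ?(gt_eqF P0) ?implybT//; apply: ler_powR; first exact: ltW.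
  have : (0 : R) <= (j - k)%:~R by rewrite ler0z subr_ge0.
  by rewrite intrB; nra.
Qed.

(** This weight is 1 for k <= 0 and p^(k a) beyond. Being nonincreasing, it leaves the whole rate
    1/r' as margin to the right; to the left it grows at rate at most -a < 1/r. *)
Lemma moderate_truncated_weight a : - r^-1 < a -> a < 0 ->
  moderate_weight (fun k => P `^ ((Num.max k 0)%:~R * a)).
Proof.
move=> a1 a2; exists (Num.min r'^-1 (r^-1 + a)).
set e := Num.min _ _.
have e1 : e <= r'^-1 by rewrite ge_min lexx.
have e2 : e <= r^-1 + a by rewrite ge_min lexx orbT.
split=> [|k|j k jk|j k kj].
- by rewrite lt_min invr_gt0 r'0; lra.
- exact: powR_gt0.
- rewrite -powRD ?(gt_eqF P0) ?implybT//; apply: ler_powR; first exact: ltW.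
  have : (0 : R) <= (k - j)%:~R by rewrite ler0z subr_ge0.
  have : (Num.max j 0)%:~R <= (Num.max k 0)%:~R :> R by rewrite ler_int; clear -jk; lia.
  by nra.
- rewrite -powRD ?(gt_eqF P0) ?implybT//; apply: ler_powR; first exact: ltW.
  have : (0 : R) <= (j - k)%:~R by rewrite ler0z subr_ge0.
  have : (Num.max j 0)%:~R - (Num.max k 0)%:~R <= (j - k)%:~R :> R.
    by rewrite -intrB ler_int; clear -kj; lia.
  by nra.
Qed.

(** * Herz norms, local integrability and boundedness *)

Lemma Herz_normE alpha q f : 0 < q ->
  Herz_norm mu alpha q r f =
  ((\esum_(k in [set: int]) (((P `^ (k%:~R * alpha))%:E * F f k) `^ q)) `^ q^-1)%E.
Proof.
move=> q0; congr (_ `^ _)%E; apply: eq_esum => k _.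
by rewrite poweRM ?lee_fin ?powR_ge0 ?sphere_norm_ge0// poweR_EFin -powRrM.
Qed.

Lemma sphere_norm_le_Herz alpha q f k : 0 < q ->
  ((P `^ (k%:~R * alpha))%:E * F f k <= Herz_norm mu alpha q r f)%E.
Proof.
move=> q0; rewrite Herz_normE//.
have pos : (0 <= (P `^ (k%:~R * alpha))%:E * F f k)%E.
  by rewrite mule_ge0 ?sphere_norm_ge0// lee_fin powR_ge0.
have {1}-> : ((P `^ (k%:~R * alpha))%:E * F f k =
    (((P `^ (k%:~R * alpha))%:E * F f k) `^ q) `^ q^-1)%E.
  by rewrite -poweRrM divff ?gt_eqF// poweRe1.
apply: le_poweR; rewrite ?invr_ge0 ?(ltW q0) ?poweR_ge0//.
apply: (esum_term_le (fun k => ((P `^ (k%:~R * alpha))%:E * F f k) `^ q)%E).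
by move=> i; exact: poweR_ge0.
Qed.

(* Near 0 the weighted sum is controlled by local [L^r]-integrability of [f],
   and at infinity by its Herz norm, since [a < alpha]. *)
Lemma truncated_weight_sum_lty a alpha q f : 0 < q -> a < alpha ->
  Herz mu alpha q r f ->
  (\esum_(j in [set: int])
     (((P `^ ((Num.max j 0)%:~R * a))%:E * F f j) `^ r) < +oo)%E.
Proof.
move=> q0 aalpha [[mf floc] fH]; set H := Herz_norm mu alpha q r f in fH.
have H0 : (0 <= H)%E by exact: poweR_ge0.
have Hfin : H \is a fin_num by rewrite ge0_fin_numE.
(* For j > 0 the weighted norm on S_j is at most p^(j (a - alpha)) times the Herz norm; the r-th
   powers form a geometric series of ratio [d]. *)
pose d := P `^ ((a - alpha) * r).
have d01 : 0 < d < 1.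
  rewrite /d powR_gt0//= -(opprK ((a - alpha) * r)) powRN invf_lt1 ?powR_gt0//.
  by rewrite powR_gt1// -mulNr opprB mulr_gt0// subr_gt0.
have [A A0 HA] := esum_geom_dist d d01.
have mB := measurable_padic_ball 0 : measurable (padic_ball 0 : set Qp).
have mfr : measurable_fun [set: Qp] (fun x => (cabs (f x) `^ r)%:E).
  by apply/measurable_EFinP/measurable_fun_powR; exact: cmeasurable_cabs.
have fr0 x : (0 <= (cabs (f x) `^ r)%:E)%E by rewrite lee_fin powR_ge0.
(* One majorant serves both signs of j: the integral over the unit ball handles j <= 0, the
   geometric term handles j > 0, and the other summand is nonnegative. *)
apply: (@le_lt_trans _ _ (\esum_(j in [set: int])
    (\int[mu]_(x in padic_ball 0 `&` padic_sphere j) (cabs (f x) `^ r)%:E +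
     (fine H `^ r)%:E * (d ^+ `|j - 0|%N)%:E))%E).
  apply: le_esum => j _; have [j0|j0] := leP j 0.
    rewrite mul0r powRr0 mul1e sphere_norm_poweR.
    rewrite (_ : padic_ball 0 `&` padic_sphere j = padic_sphere j); last first.
      apply/setIidr => x /padic_sphereP xj; rewrite /padic_ball/= xj.
      by rewrite ler_eXz2l.
    by rewrite leeDl// mule_ge0 ?lee_fin ?powR_ge0// exprn_ge0// ltW; case/andP: d01.
  rewrite -[leLHS]add0e; apply: leeD; first exact: integral_ge0.
  have -> : ((fine H `^ r)%:E * (d ^+ `|j - 0|%N)%:E =
      ((P `^ (j%:~R * (a - alpha)))%:E * H) `^ r)%E.
    have -> : d ^+ `|j - 0|%N = (P `^ (j%:~R * (a - alpha))) `^ r.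
      rewrite /d -(powR_mulrn _ (powR_ge0 P _)) -!powRrM; congr (_ `^ _).
      by rewrite subr0 -[_%:R]/(`|j|%N%:~R) gtz0_abs//; ring.
    by rewrite poweRM ?lee_fin ?powR_ge0// -[in RHS](fineK Hfin) !poweR_EFin muleC.
  apply: le_poweR; first exact: ltW.
    by rewrite mule_ge0 ?sphere_norm_ge0// lee_fin powR_ge0.
  have -> : P `^ (j%:~R * a) = P `^ (j%:~R * (a - alpha)) * P `^ (j%:~R * alpha).
    by rewrite -powRD ?(gt_eqF P0) ?implybT//; congr (_ `^ _); ring.
  rewrite EFinM -muleA lee_wpmul2l ?lee_fin ?powR_ge0//.
  exact: sphere_norm_le_Herz.
rewrite esumD; last 2 first.
- by move=> j _; exact: integral_ge0.
- move=> j _; rewrite mule_ge0 ?lee_fin ?powR_ge0// exprn_ge0// ltW//.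
  by case/andP: d01.
rewrite -integral_padic_spheres//; apply: lte_add_pinfty; first exact: floc.
have dn j : (0 <= (d ^+ `|j - 0|%N)%:E)%E.
  by rewrite lee_fin exprn_ge0// ltW//; case/andP: d01.
apply: le_lt_trans (esumZl_le _ _ _ (powR_ge0 _ _) dn) _.
apply: le_lt_trans (lee_wpmul2l _ (HA 0)) _; first by rewrite lee_fin powR_ge0.
by rewrite -EFinM ltry.
Qed.

(** Taking the weighted estimate with exponent r turns the sum over spheres into an integral of |T_b
    f|^r. The truncated weight is bounded below on the spheres of any fixed ball, so the integral
    over that ball is finite. *)
Lemma Lloc_HLP_commutator alpha q f : - r^-1 < alpha -> 0 < q ->
  Herz mu alpha q r f -> (forall k, (I f k < +oo)%E) ->
  Lloc mu r (HLP_commutator mu b f).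
Proof.
move=> a1 q0 fH If; have [[mf _] _] := fH.
set g := HLP_commutator mu b f; have mg := cmeasurable_HLP_commutator f.
split => // k.
(* The midpoint of -1/r and min(alpha, 0). *)
pose a := (Num.min alpha 0 - r^-1) / 2.
have r'p : 0 < r^-1 by rewrite invr_gt0.
have amin : - r^-1 < Num.min alpha 0 by rewrite lt_min a1 oppr_lt0.
have aa : - r^-1 < a by rewrite /a ltr_pdivlMr//; lra.
have am : a < Num.min alpha 0 by rewrite /a ltr_pdivrMr//; lra.
have /andP[aalpha a0] : (a < alpha) && (a < 0) by rewrite -lt_min.
have mW := moderate_truncated_weight aa a0.
have [C C0 HC] := weighted_commutator_le mW r0.
pose W j := P `^ ((Num.max j 0)%:~R * a).
have W0 j : 0 < W j by exact: powR_gt0.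
have mB := measurable_padic_ball k : measurable (padic_ball k : set Qp).
have mgr : measurable_fun [set: Qp] (fun x => (cabs (g x) `^ r)%:E).
  by apply/measurable_EFinP/measurable_fun_powR; exact: cmeasurable_cabs.
have gr0 x : (0 <= (cabs (g x) `^ r)%:E)%E by rewrite lee_fin powR_ge0.
rewrite integral_padic_spheres//.
(* [W] is nonincreasing, so W j / W k >= 1 on the spheres with j <= k, which are those that meet
   B_k. *)
apply: (@le_lt_trans _ _ (\esum_(j in [set: int])
    (((W k)^-1 `^ r)%:E * ((W j)%:E * F g j) `^ r))%E).
  apply: le_esum => j _; have [jk|kj] := leP j k.
    rewrite (_ : padic_ball k `&` padic_sphere j = padic_sphere j); last first.
      apply/setIidr => x /padic_sphereP xj; rewrite /padic_ball/= xj.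
      by rewrite ler_eXz2l.
    rewrite -sphere_norm_poweR -poweR_EFin -poweRM; last 2 first.
    - by rewrite lee_fin invr_ge0 ltW.
    - by rewrite mule_ge0 ?sphere_norm_ge0// lee_fin ltW.
    apply: le_poweR; rewrite ?sphere_norm_ge0 ?(ltW r0)//.
    rewrite muleA -EFinM -[leLHS]mul1e lee_wpmul2r ?sphere_norm_ge0// lee_fin.
    rewrite mulrC ler_pdivlMr// mul1r; apply: ler_powR; first exact: ltW.
    by rewrite ler_wnM2r ?(ltW a0)// ler_int ge_max !le_max jk lexx orbT.
  rewrite (_ : padic_ball k `&` padic_sphere j = set0).
    by rewrite integral_set0 mule_ge0 ?poweR_ge0// lee_fin powR_ge0.
  rewrite -subset0 => x [xk /padic_sphereP xj]; move: xk.
  by rewrite /padic_ball/= xj ler_eXz2l// leNgt kj.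
apply: le_lt_trans (esumZl_le _ _ _ _ _) _ => [||].
- exact: powR_ge0.
- by move=> j; exact: poweR_ge0.
rewrite lte_mul_pinfty ?lee_fin ?powR_ge0//.
apply: le_lt_trans (HC f mf If) _.
rewrite lte_mul_pinfty ?lee_fin ?(ltW C0)//.
exact: truncated_weight_sum_lty fH.
Qed.

Lemma HLP_commutator_bounded alpha q1 q2 : 0 < q1 -> q1 <= q2 ->
  - r^-1 < alpha -> alpha < r'^-1 ->
  bounded_operator (HLP_commutator_defined mu b) (HLP_commutator mu b)
    (Herz mu alpha q1 r) (Herz_norm mu alpha q1 r)
    (Herz mu alpha q2 r) (Herz_norm mu alpha q2 r).
Proof.
move=> q10 q12 a1 a2; have q20 := lt_le_trans q10 q12.
have mW := moderate_power_weight a1 a2.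
have [C C0 HC] := weighted_commutator_le mW q10.
exists (C `^ q1^-1) => f fH; have [[mf _] fHfin] := fH.
have fsum : (\esum_(j in [set: int])
    (((P `^ (j%:~R * alpha))%:E * F f j) `^ q1) < +oo)%E.
  by move: fHfin; rewrite Herz_normE// => /lty_poweRy; apply; rewrite invr_eq0 gt_eqF.
have If := oscillation_integral_lty mW q10 mf fsum.
have bound : (Herz_norm mu alpha q2 r (HLP_commutator mu b f) <=
    (C `^ q1^-1)%:E * Herz_norm mu alpha q1 r f)%E.
  (* The embedding of l^q1 in l^q2 is applied to T_b f, so that the weighted estimate is used with
     the single exponent q1. *)
  rewrite !Herz_normE//; apply: le_trans (esum_poweR_le _ _ _ q10 q12 _) _.
    by move=> k; rewrite mule_ge0 ?sphere_norm_ge0// lee_fin powR_ge0.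
  have s0 g : (0 <= \esum_(j in [set: int])
      (((P `^ (j%:~R * alpha))%:E * F g j) `^ q1))%E.
    by apply: esum_ge0 => j _; exact: poweR_ge0.
  rewrite -poweR_EFin -poweRM ?lee_fin ?(ltW C0)//.
  by apply: le_poweR; [rewrite invr_ge0 ltW|exact: s0|exact: HC].
split => //; first exact: HLP_commutator_is_defined.
split; first exact: Lloc_HLP_commutator fH If.
by apply: le_lt_trans bound _; rewrite lte_mul_pinfty// lee_fin powR_ge0.
Qed.

End MainEstimate.

Theorem theorem3p2 (R : realType) (p : nat) (p_pr : prime p)
    (mu : {measure set (@Qp R p p_pr) -> \bar R}) (mu_haar : normalized_haar mu)
    (q1 q2 r r' alpha : R) (b : @Qp R p p_pr -> R[i]) :
  0 < q1 -> q1 <= q2 ->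
  1 < r -> r^-1 + r'^-1 = 1 ->
  - r^-1 < alpha -> alpha < r'^-1 ->
  CMO mu (Num.max r' r) b ->
  bounded_operator (HLP_commutator_defined mu b) (HLP_commutator mu b)
    (Herz mu alpha q1 r) (Herz_norm mu alpha q1 r)
    (Herz mu alpha q2 r) (Herz_norm mu alpha q2 r).
Proof.
move=> q10 q12 r1 rr' a1 a2 bC; have [[mb _] _] := bC.
have r'0 : 0 < r'.
  rewrite -invr_gt0 (_ : r'^-1 = 1 - r^-1); last by rewrite -rr' addrAC subrr add0r.
  by rewrite subr_gt0 invf_lt1// (lt_trans ltr01).
have s1 : 1 <= Num.max r' r by rewrite le_max (ltW r1) orbT.
have [K [beta [K0 moment lip]]] := CMO_approximation mu_haar s1 bC.
apply: (HLP_commutator_bounded mu_haar r1 rr' mb K0 _ lip) => // k t [] ->.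
  by apply: moment; rewrite ?le_max ?lexx ?orbT// ltW// (lt_trans ltr01).
by apply: moment; rewrite ?le_max ?lexx// ltW.
Qed.
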